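(* Every Sturmian number is transcendental: if $\beta>1$ and $d_\beta(1)$ is a Sturmian word over an alphabet $\{a,b\}$ with $0\le a<b=\lfloor\beta\rfloor$, then $\beta$ is transcendental.
   Context: For $\beta>1$, $T_\beta(x)=\beta x\bmod1$ on $[0,1]$ and the $\beta$-expansion of $1$ is $d_\beta(1)=(x_i)_{i\ge1}$ with $x_i=\lfloor\beta T_\beta^{i-1}(1)\rfloor$. A Sturmian word is an infinite word over a two-letter alphabet having exactly $n+1$ distinct factors of length $n$ for every $n\ge0$. *)

(* Defs.v *)
From HB Require Import structures.
From mathcomp Require Import all_boot all_order all_algebra.
From mathcomp Require Import boolp classical_sets functions cardinality reals.

Set Implicit Arguments.
Unset Strict Implicit.
Unset Printing Implicit Defensive.

Import Order.TTheory GRing.Theory Num.Theory.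
Local Open Scope classical_set_scope.
Local Open Scope card_scope.
Local Open Scope ring_scope.

Definition beta_map (R : realType) (beta x : R) : R :=
  beta * x - (Num.floor (beta * x))%:~R.

(* Indexed from 0: [beta_expansion1 beta i] is the digit x_{i+1}. *)
Definition beta_expansion1 (R : realType) (beta : R) (i : nat) : int :=
  Num.floor (beta * iter i (beta_map beta) 1).

Definition factors (A : Type) (w : nat -> A) (n : nat) : set (seq A) :=
  range (fun i : nat => mkseq (fun k : nat => w (i + k)%N) n).

Definition sturmian_over (A : Type) (a b : A) (w : nat -> A) : Prop :=
  [/\ a <> b,
      forall i : nat, w i = a \/ w i = b
    & forall n : nat, factors w n #= `I_n.+1].

Definition transcendental (R : realType) (x : R) : Prop :=
  ~ algebraicOver (ratr : rat -> R) x.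

(* Main.v *)
Require Import Defs.
From HB Require Import structures.
From mathcomp Require Import all_boot all_order all_algebra perm finmap.
From mathcomp Require Import boolp classical_sets functions cardinality reals sequences exp.
From mathcomp Require Import zify ring lra.

(* Mahler's method for the Hecke-Mahler series, with a varying slope.

   The expansion x of 1 is a Sturmian word that is lexicographically maximal among its shifts.
   Such a word is the image of another one under 1 -> 1, 0 -> 10 or under 1 -> 10, 0 -> 0, so x
   is described by a sequence d of choices between these two substitutions and by the words W n
   obtained after n steps. Put z = 1/beta, let u_n and v_n be z to the lengths of the n-th images
   of 0 and 1, and let H(u, v) be the sum, over the occurrences of 1 in W n, of the monomial u^i v^j
   counting the letters 0 and 1 before it. The equation sum x_i z^i = 1 makes h_n = H(u_n, v_n)
   a rational function of z of height O(len) (the determinant [level_det] is a monomial times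
   1 - z). If z is algebraic, Liouville's inequality then bounds every nonzero
   P(u_n, v_n, h_n), with P an integer polynomial of partial degrees < m, from below by
   A^-1 B^(-m len), where B does not depend on m.

   If d has arbitrarily long runs, P = H - 1 or P = 1 - (1 - v) H violates this bound. Otherwise
   take a limit d' of the shifts of d, and P with P(u, v, H_d') vanishing at all u^i v^j with
   i, j < M, where M is of order m^(3/2). The value P(u_n, v_n, h_n) is too small along the n at
   which d looks like d'; it is nonzero because len0/len1 stays away from each rational
   number, so that one monomial dominates, and because H_d' is transcendental over Q(u, v): it
   blows up along the whole curve v = u^(-theta), theta irrational, on which a nonzero polynomial
   in u and v cannot vanish identically. *)

Set Implicit Arguments.
Unset Strict Implicit.
Unset Printing Implicit Defensive.

(** * Desubstitution of Sturmian words *)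

Fixpoint occ (x : nat -> bool) (i : nat) (v : seq bool) : bool :=
  if v is l :: v' then (x i == l) && occ x i.+1 v' else true.

Lemma occ_cat x i s t : occ x i (s ++ t) = occ x i s && occ x (i + size s) t.
Proof.
elim: s i => [|l s IH] i /=; first by rewrite addn0.
by rewrite IH andbA addSnnS.
Qed.

Lemma occ_nth x i s : occ x i s -> forall k, k < size s -> x (i + k) = nth false s k.
Proof.
elim: s i => [|l s IH] i //= /andP[/eqP xi Hs] [|k] Hk; first by rewrite addn0.
by rewrite addnS -addSn IH.
Qed.

Definition right_special x v :=
  (exists i, occ x i (rcons v true)) /\ (exists i, occ x i (rcons v false)).

(** A Sturmian word has a single right special factor of each length, so [false :: w] and
    [true :: w] are never both right special. Only this consequence of the complexity is kept,
    because it passes directly to desubstituted words. *)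
Definition rs_chain x :=
  forall w, right_special x (false :: w) -> right_special x (true :: w) -> False.

Definition aperiodic (x : nat -> bool) :=
  forall N p, 0 < p -> exists2 i, N <= i & x (i + p) != x i.

(** Lexicographic maximality among the shifts, with 0 < 1, read at the first possible disagreement
    [n]. *)
Definition shift_max (x : nat -> bool) :=
  forall k n, (forall i, i < n -> x (k + i) = x i) -> x (k + n) -> x n.

Definition good x := [/\ rs_chain x, aperiodic x & shift_max x].

Lemma right_special_suffix x s v : right_special x (s ++ v) -> right_special x v.
Proof.
by case=> -[i Hi] [j Hj]; split; [exists (i + size s)|exists (j + size s)];
  move: Hi Hj; rewrite !rcons_cat !occ_cat => /andP[_ ?] /andP[_ ?].
Qed.

Lemma aperiodic_change x l : aperiodic x -> exists i, x i = l /\ x i.+1 = ~~ l.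
Proof.
move=> Hx; apply/not_existsP => H.
have stay i : x i = l -> x i.+1 = l.
  by move=> xi; move: (H i); rewrite xi; case: (x i.+1) (l) => -[] // [].
have [i _] := Hx 0 1 isT; rewrite addn1 => xi.
have xSi : x i.+1 = l.
  have [xl|] := eqVneq (x i) l; first exact: stay.
  by move: xi; case: (x i) (x i.+1) l {stay H} => -[] [].
have all_l k : x (i.+1 + k) = l.
  by elim: k => [|k IH]; rewrite ?addn0 // addnS; exact: stay.
have [j Hj] := Hx i.+1 1 isT; rewrite addn1 -(subnKC Hj) -addnS !all_l.
by rewrite eqxx.
Qed.

Lemma good0 x : good x -> x 0.
Proof.
case=> _ /(aperiodic_change true)[i [xi _]] /(_ i 0).
by rewrite addn0 xi; apply.
Qed.

(** Both 01 and 10 occur by aperiodicity. If 00 and 11 occurred too, the letters 0 and 1 would both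
    be right special, against [rs_chain] for the empty word. *)
Lemma good_no_square x : good x -> exists c, forall i, x i = ~~ c -> x i.+1 = c.
Proof.
case=> Hrs Hap _.
have [i [i0 i1]] := aperiodic_change true Hap.
have [j [j0 j1]] := aperiodic_change false Hap.
have [[k [k0 k1]]|H] := pselect (exists k, x k = false /\ x k.+1 = false); last first.
  exists true => k xk; apply/negPn/negP => /negbTE xk1; apply: H; by exists k.
exists false => m xm; apply/negP => xm1.
apply: (Hrs [::]); split.
- by exists j; rewrite /= j0 j1.
- by exists k; rewrite /= k0 k1.
- by exists m; rewrite /= xm xm1.
- by exists i; rewrite /= i0 i1.
Qed.

(* [tau true] maps 1 to 1 and 0 to 10, [tau false] maps 1 to 10 and 0 to 0. *)
Definition tau (c l : bool) : seq bool := if l == c then [:: c] else [:: true; false].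

Definition sub (c : bool) (w : seq bool) : seq bool := flatten (map (tau c) w).

Lemma sub_cat c v w : sub c (v ++ w) = sub c v ++ sub c w.
Proof. by rewrite /sub map_cat flatten_cat. Qed.

Lemma sub_rcons c v l : sub c (rcons v l) = sub c v ++ tau c l.
Proof. by rewrite -cats1 sub_cat /sub /= cats0. Qed.

(** Encodes that the infinite word [x] is the image of [y] under [tau c]; [pos] lists the cutting
    points. *)
Record desub (c : bool) (y x : nat -> bool) (pos : nat -> nat) : Prop := Desub {
  pos0 : pos 0 = 0;
  posS : forall k, pos k.+1 = pos k + size (tau c (y k));
  desub_occ : forall k, occ x (pos k) (tau c (y k)) }.

(** Parsing from the left determines the blocks. For [c = true] they are 1 and 10, told apart by the
    letter after the initial 1; for [c = false] they are 10 and 0, told apart by their first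
    letter. *)
Lemma desub_exists c (x : nat -> bool) : x 0 -> (forall i, x i = ~~ c -> x i.+1 = c) ->
  exists y pos, desub c y x pos.
Proof.
move=> x0 Hc.
pose lett p := if c then x p.+1 else x p.
pose pos := fix pos k := if k is k'.+1 then pos k' + size (tau c (lett (pos k'))) else 0.
exists (fun k => lett (pos k)), pos; split => // k.
have start : c -> x (pos k).
  move=> ct; move: Hc; rewrite /pos /lett /tau ct => Hc.
  elim: k => [|k IH] //=; set p := _ k in IH *.
  case E: (x p.+1); first by rewrite /= addn1 E.
  by rewrite /= addn2 Hc.
rewrite /lett /tau; move: (pos k) start => p; case: c Hc {lett pos} => Hc start.
  by case E: (x p.+1); rewrite /= ?start //= E.
by case E: (x p) => //=; rewrite ?E ?Hc.
Qed.

Section Desub.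
Variables (c : bool) (x y : nat -> bool) (pos : nat -> nat).
Hypothesis dsb : desub c y x pos.

Lemma desub_sub i v : occ y i v ->
  pos (i + size v) = pos i + size (sub c v) /\ occ x (pos i) (sub c v).
Proof.
elim: v i => [|l v IH] i /=; first by rewrite !addn0.
case/andP => /eqP <- /IH[E1 E2]; rewrite -addSnnS E1 (posS dsb) size_cat addnA.
by split=> //; rewrite occ_cat (desub_occ dsb) /= -(posS dsb).
Qed.

Lemma desub_start k : c -> x (pos k).
Proof. by move: (desub_occ dsb k); case: c; case: (y k) => //= /andP[/eqP->]. Qed.

Lemma pos_lt k : pos k < pos k.+1.
Proof. by rewrite (posS dsb) /tau; case: ifP => _ /=; rewrite ?addn1 ?addn2. Qed.

Lemma pos_ge k : k <= pos k.
Proof. by elim: k => // k IH; apply: leq_ltn_trans IH (pos_lt k). Qed.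

Lemma pos_cover i m : pos i <= m -> exists k j,
  [/\ i <= k, j < size (tau c (y k)) & m = pos k + j].
Proof.
move=> Hm; have exP : exists k, pos k <= m by exists i.
have ubP k : pos k <= m -> k <= m by apply: leq_trans (pos_ge k).
have [k Hk Hk'] := ex_maxnP exP ubP.
exists k, (m - pos k); split; rewrite ?subnKC //; first exact: Hk'.
have: m < pos k.+1 by rewrite ltnNge; apply/negP => /Hk'; rewrite ltnn.
rewrite (posS dsb); lia.
Qed.

(** For [c = true] the blocks 1 and 10 share their first letter and a lone 1 is followed by a block
    starting with 1, so the branching is delayed by one 1. For [c = false] the blocks 10 and 0
    branch at once. *)
Lemma desub_right_special w : right_special y w -> right_special x (sub c w ++ nseq c true).
Proof.
have key i l : occ y i (rcons w l) -> occ x (pos i) (rcons (sub c w ++ nseq c true) l).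
  move=> /desub_sub[E1 E2]; move: (desub_start (i + size (rcons w l))); rewrite E1.
  move: E2 {E1}; rewrite !sub_rcons size_cat addnA -cats1 -catA !occ_cat => /andP[-> /=].
  case: c; case: l => /=; rewrite ?addn0 ?addn1 ?andbT //.
    by move=> -> /(_ isT) ->.
  by case/andP => ->.
by case=> -[i /key Hi] [j /key Hj]; split; [exists (pos i)|exists (pos j)].
Qed.

Lemma desub_good : good x -> y 0 -> good y.
Proof.
move=> [Hrs Hap Hmax] y0; split.
- move=> w Hf Ht.
  case Ec: c.
    apply: (Hrs (sub true w ++ [:: true])).
      by apply: (@right_special_suffix _ [:: true]); move: (desub_right_special Hf); rewrite Ec.
    by move: (desub_right_special Ht); rewrite Ec.
  (* Under [tau false] the images of 0w and 1w both end in 0 followed by the image of w. The letter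
     before [false :: w], which exists since [y 0] is 1, has an image ending in 0; this 0 is set
     against the 1 of the block 10. *)
  apply: (Hrs (false :: sub false w)); last first.
    by move: (desub_right_special Ht); rewrite Ec /= cats0.
  have prec i l : occ y i (rcons (false :: w) l) -> exists j, occ y j (rcons (y j :: false :: w) l).
    case: i => [|i]; first by rewrite /= y0.
    by move=> H; exists i; rewrite /= eqxx; exact: H.
  have tail i l : occ y i (rcons (y i :: false :: w) l) ->
      exists j, occ x j (rcons (false :: false :: sub false w) l).
    move=> /desub_sub[_]; rewrite sub_rcons Ec.
    have -> : sub false (y i :: false :: w) = nseq (y i) true ++ false :: false :: sub false w.
      by rewrite /sub /=; case: (y i).
    rewrite -catA occ_cat => /andP[_ H]; exists (pos i + size (nseq (y i) true)).
    move: H; rewrite -cats1 !occ_cat => /andP[-> /=].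
    by case: l => //= /andP[->].
  case: Hf => -[i /prec[i' /tail Hi]] [j /prec[j' /tail Hj]]; by split.
(* A period [p] of [y] from [N] on would give [x] the period [q], the length of the image of one
   period. *)
- move=> N p p0; apply/not_exists2P => H.
  have per i : N <= i -> y (i + p) = y i.
    by move=> Hi; case: (H i) => // /negP; rewrite negbK => /eqP.
  pose q := pos (N + p) - pos N.
  have posq k : pos (N + k + p) = pos (N + k) + q.
    elim: k => [|k IH].
      by rewrite addn0 /q subnKC // -addnC; elim: (p) => // r /leq_trans; apply; rewrite addSn ltnW // pos_lt.
    by rewrite addnS addSn !(posS dsb) IH per ?leq_addr // addnAC.
  have q0 : 0 < q.
    rewrite /q subn_gt0 -addn1; case: p p0 {H per q posq} => // p _.
    elim: p => [|p IH]; first by rewrite !addn1 pos_lt.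
    by apply: leq_trans IH _; rewrite (addnS _ p.+1) ltnW // pos_lt.
  have [m Hm] := Hap (pos N) q q0.
  have [k [j [Hk Hj ->]]] := pos_cover Hm.
  have := occ_nth (desub_occ dsb k) Hj => ->.
  rewrite addnAC -{1}(subnKC Hk) -posq subnKC //.
  by have := occ_nth (desub_occ dsb (k + p)); rewrite per // => ->; rewrite // eqxx.
(* The images agree up to the blocks of [y (k + n) = 1] and [y n = 0]. These then compare as 11
   against 10 for [c = true] and as 1 against 0 for [c = false], so [x] would not be maximal. *)
- move=> k n Heq yk; apply/negPn/negP => /negbTE yn.
  have posk i : i <= n -> pos (k + i) = pos k + pos i.
    elim: i => [|i IH] Hi; first by rewrite addn0 (pos0 dsb) addn0.
    by rewrite addnS !(posS dsb) IH 1?ltnW // Heq // addnA.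
  have agree m : m < pos n -> x (pos k + m) = x m.
    move=> Hm; have [|i [j [_ Hj E]]] := @pos_cover 0 m; first by rewrite (pos0 dsb).
    have Hi : i < n.
      rewrite ltnNge; apply/negP => Hni; move: Hm; rewrite E ltnNge; apply/negP/negPn.
      apply: leq_trans (leq_addr _ _).
      elim: i {Hj E} Hni => [|i IH]; first by rewrite leqn0 => /eqP->.
      by rewrite leq_eqVlt => /orP[/eqP->//|/IH/leq_trans]; apply; rewrite ltnW // pos_lt.
    rewrite E addnA -posk 1?ltnW // (occ_nth (desub_occ dsb i)) //.
    by have := occ_nth (desub_occ dsb (k + i)); rewrite Heq // => ->.
  have Ok := desub_occ dsb (k + n); have On := desub_occ dsb n.
  rewrite yk yn posk // in Ok On.
  case Ec: c Ok On => /=.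
    case/andP=> /eqP Ok _ /and3P[/eqP On1 /eqP On2 _].
    suff : false by [].
    rewrite -On2; apply: (Hmax (pos k)).
      by move=> i; rewrite ltnS leq_eqVlt => /orP[/eqP->|/agree//]; rewrite Ok.
    have := @desub_start (k + n).+1 Ec; rewrite (posS dsb) yk Ec /= posk //.
    by rewrite addn1 addnS.
  case/and3P=> /eqP Ok _ _ /andP[/eqP On _].
  suff : false by [].
  by rewrite -On; apply: (Hmax (pos k) _ agree); rewrite Ok.
Qed.

End Desub.

Lemma good_desub x : good x -> exists c y pos, desub c y x pos /\ good y.
Proof.
move=> Hx; have [c Hc] := good_no_square Hx.
have [y [pos dsb]] := desub_exists (good0 Hx) Hc.
exists c, y, pos; split=> //; apply: (desub_good dsb Hx).
apply/negPn/negP => /negbTE y0.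
have x0 := good0 Hx; have := desub_occ dsb 0; rewrite y0 (pos0 dsb).
case: c Hc dsb => Hc dsb /=; last by rewrite x0.
move=> /and3P[_ /eqP x1 _].
(* What remains is [c = true] with [x] starting with 10. Maximality then forbids 11 while 00 is
   already excluded, so [x] would alternate. *)
case: (Hx) => _ Hap Hmax.
have [i [xi xi1]] := aperiodic_change false Hap.
have nott j : x j -> x j.+1 = false.
  move=> xj; apply/negP => xj1; suff : false by [].
  rewrite -x1; apply: (Hmax j); last by rewrite addn1.
  by case=> // _; rewrite addn0 xj x0.
have alt k : x (k + 2) = x k.
  rewrite addn2; case E: (x k); first by rewrite Hc // nott.
  by rewrite nott // Hc.
by have [j _] := Hap 0 2 isT; rewrite alt eqxx.
Qed.

(** * Directive sequences *)

Fixpoint sig (d : nat -> bool) (n : nat) (w : seq bool) : seq bool :=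
  if n is n'.+1 then sig d n' (sub (d n') w) else w.

(** [sig d n] applies [tau (d n.-1)] first and [tau (d 0)] last. Its recursion peels off the
    innermost substitution, this lemma the outermost. *)
Lemma sig_outer d n w : sig d n.+1 w = sub (d 0) (sig (fun i => d i.+1) n w).
Proof. by elim: n w => // n IH w; rewrite /= -IH. Qed.

Definition pref d k := sig d k [:: true].

Lemma eq_sig d d' n w : (forall i, i < n -> d i = d' i) -> sig d n w = sig d' n w.
Proof.
elim: n w => // n IH w H /=; rewrite H // IH // => i Hi; apply: H; exact: ltnW.
Qed.

Lemma sig_add d n k w : sig d (n + k) w = sig d n (sig (fun i => d (n + i)) k w).
Proof. by elim: k w => [|k IH] w; rewrite ?addn0 // addnS /= IH. Qed.

(** [W n] is the image of [W n.+1] under [tau (d n)], stated on prefixes. When [d n] is true every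
    block starts with 1, which gives the extra letter. *)
Definition directive (W : nat -> nat -> bool) (d : nat -> bool) :=
  [/\ forall n, good (W n) & forall n v, occ (W n.+1) 0 v ->
     occ (W n) 0 (sub (d n) v ++ nseq (d n) true)].

Theorem good_directive x : good x -> exists W d, directive W d /\ W 0 = x.
Proof.
move=> Hx.
pose gw := {y | good y}.
have step (y : gw) : {p : bool * gw & exists pos, desub p.1 (sval p.2) (sval y) pos}.
  apply/cid; case: y => y Hy; have [c [y' [pos [H1 H2]]]] := good_desub Hy.
  by exists (c, exist _ y' H2), pos.
pose W n : gw := iter n (fun y => (projT1 (step y)).2) (exist _ x Hx).
exists (fun n => sval (W n)), (fun n => (projT1 (step (W n))).1).
split=> //; split=> [n|n v Hv]; first exact: svalP.
have [pos dsb] := projT2 (step (W n)).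
have [E1 E2] := desub_sub dsb Hv.
rewrite (pos0 dsb) in E1 E2; rewrite occ_cat E2 -E1.
by have := desub_start dsb (0 + size v); case: ((projT1 _).1) => //= ->.
Qed.

Section Directive.
Variables (W : nat -> nat -> bool) (d : nat -> bool).
Hypothesis dW : directive W d.

Lemma directive0 n : W n 0.
Proof. by case: dW => H _; apply: good0. Qed.

Lemma directive_sig n m v : occ (W (n + m)) 0 v -> occ (W n) 0 (sig (fun i => d (n + i)) m v).
Proof.
case: dW => _ H; elim: m v => [|m IH] v; first by rewrite addn0.
by rewrite addnS => /H; rewrite occ_cat => /andP[/IH].
Qed.

Lemma directive_pref n k : occ (W n) 0 (pref (fun i => d (n + i)) k).
Proof. by apply: directive_sig; rewrite /= directive0. Qed.

(** Each [tau true] of the run lengthens the initial block of ones by one letter, and each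
    [tau false] turns an initial [1 0^k] into [1 0^(k+1)]. *)
Lemma directive_run c r n : (forall i, i < r -> d (n + i) = c) ->
  occ (W n) 0 (if c then nseq r.+1 true else true :: nseq r false).
Proof.
case: dW => _ HW.
elim: r n => [|r IH] n H; first by rewrite if_same /= directive0.
have {}IH : occ (W n.+1) 0 (if c then nseq r.+1 true else true :: nseq r false).
  by apply: IH => i Hi; rewrite addSnnS H.
have := HW n _ IH; rewrite -[n]addn0 H // addn0; case: (c).
  suff -> : sub true (nseq r.+1 true) = nseq r.+1 true.
    by rewrite -[nseq true _]/(nseq 1 true) -nseqD addn1.
  by rewrite /sub; elim: (r.+1) => //= q ->.
suff -> : sub false (true :: nseq r false) = true :: nseq r.+1 false by rewrite cats0.
by rewrite /sub /=; congr (_ :: _ :: _); elim: (r) => //= q ->.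
Qed.

(** By [directive_run], a constant tail of [d] would make some [W n] constant after its first
    letter, against aperiodicity. *)
Lemma directive_recurrent c n : exists2 m, n <= m & d m = c.
Proof.
apply/not_exists2P => H.
have dn m : n <= m -> d m = ~~ c.
  by move=> Hm; case: (H m) => //; case: (d m); case: (c).
have Hk k : occ (W n) 0 (if ~~ c then nseq k.+1 true else true :: nseq k false).
  by apply: directive_run => i _; rewrite dn // leq_addr.
have [/(_ n)[_ Hap _] _] := dW.
have [i Hi] := Hap 1 1 isT; rewrite addn1.
have Pn k : 0 < k -> W n k = ~~ c.
  move=> k0; have := @occ_nth _ _ _ (Hk k) k; rewrite add0n => ->.
    case: (c); last by rewrite nth_nseq ltnS leqnn.
    case: k k0 => // k _; have := @nth_nseq _ false k.+1 false k; rewrite if_same; exact.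
  by case: (c); rewrite /= size_nseq.
by rewrite !Pn // eqxx.
Qed.

End Directive.

(** * Sturmian expansions of 1 *)

Import Order.TTheory GRing.Theory Num.Theory.
Local Open Scope ring_scope.

(** The map [g] chooses one right extension for each of the [n.+1] factors of length [n]. Two of
    these factors have a further extension, which makes [n.+3] factors of length [n.+1]. *)
Lemma factors_two_right_special (T : choiceType) (w : nat -> T) (n i i' j j' : nat) :
  (factors w n #= `I_n.+1)%card -> (factors w n.+1 #= `I_n.+2)%card ->
  let f k := mkseq (fun l => w (k + l)%N) n in
  f i = f i' -> f j = f j' -> f i <> f j ->
  w (i + n)%N <> w (i' + n)%N -> w (j + n)%N <> w (j' + n)%N -> False.
Proof.
move=> cn cn1 f fi fj fij wi wj.
pose f1 k := mkseq (fun l => w (k + l)%N) n.+1.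
have f1E k : f1 k = rcons (f k) (w (k + n)%N) by rewrite /f1 /f mkseqS.
pose s := enum_fset (fset_set (factors w n)); pose s1 := enum_fset (fset_set (factors w n.+1)).
have fin : finite_set (factors w n) by apply/finite_setP; eexists; exact: cn.
have fin1 : finite_set (factors w n.+1) by apply/finite_setP; eexists; exact: cn1.
have us : uniq s by exact: fset_uniq.
have ss : size s = n.+1 by exact: card_fset_set.
have ss1 : size s1 = n.+2 by exact: card_fset_set.
have ins v : v \in s -> exists k, f k == v.
  rewrite in_fset_set // => /set_mem[k _ <-]; by exists k.
have ins1 k : f1 k \in s1 by rewrite in_fset_set //; apply/mem_set; exists k.
pose g v := if pselect (exists k, f k == v) is left H then f1 (xchoose H) else [::].
have gE v : v \in s -> exists2 k, f k = v & g v = f1 k.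
  move=> vs; rewrite /g; case: pselect => [H|/(_ (ins v vs))//].
  by exists (xchoose H) => //; apply/eqP; exact: xchooseP H.
have fs k : f k \in s by rewrite in_fset_set //; apply/mem_set; exists k.
have rc (v v' : seq T) x x' : rcons v x = rcons v' x' -> v = v' /\ x = x'.
  by move/eqP; rewrite eqseq_rcons => /andP[/eqP-> /eqP->].
have other k k' : f k = f k' -> w (k + n)%N <> w (k' + n)%N ->
    exists2 m, f m = f k & f1 m <> g (f k).
  move=> fk wk; have [m fm gm] := gE _ (fs k); rewrite gm.
  case: (eqVneq (w (m + n)%N) (w (k + n)%N)) => [E|/eqP E].
    by exists k' => //; rewrite !f1E => /rc[_]; rewrite E => /esym.
  by exists k => //; rewrite !f1E => /rc[_ /esym].
have [p fp gp] := other _ _ fi wi; have [q fq gq] := other _ _ fj wj.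
have ginj : {in s &, injective g}.
  move=> v v' /gE[k <- ->] /gE[k' <- ->]; by rewrite !f1E => /rc[].
have notg k : f1 k <> g (f k) -> f1 k \notin map g s.
  move=> H; apply/negP => /mapP[v vs E]; apply: H; rewrite {1}E.
  by have [m fm gm] := gE v vs; move: E; rewrite gm !f1E => /rc[-> _]; rewrite fm gm f1E fm.
have uq : uniq (f1 p :: f1 q :: map g s).
  rewrite /= (map_inj_in_uniq ginj) us andbT inE negb_or !notg ?fp ?fq // !andbT.
  by apply/eqP; rewrite !f1E fp fq => /rc[].
have := uniq_leq_size uq (s2 := s1); rewrite /= size_map ss ss1.
suff H : {subset f1 p :: f1 q :: map g s <= s1} by move=> /(_ H); rewrite ltnn.
move=> v; rewrite !inE => /or3P[/eqP->|/eqP->|/mapP[v' /gE[k _ ->] ->]] //.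
Qed.

(** A word of period [p] from [N] on has at most [N + p] factors of any given length; the length
    [N + p] gives the contradiction. *)
Lemma sturmian_aperiodic (T : Type) (w : nat -> T) (N p : nat) : (0 < p)%N ->
  (forall n, (factors w n #= `I_n.+1)%card) ->
  exists2 i, (N <= i)%N & w (i + p)%N <> w i.
Proof.
move=> p0 cn; apply/not_exists2P => H.
have per i : (N <= i)%N -> w (i + p)%N = w i.
  by move=> Hi; case: (H i) => // /contrapT.
have red i : exists2 j, (j < N + p)%N & forall k, w (i + k)%N = w (j + k)%N.
  elim/ltn_ind: i => i IH; have [Hi|Hi] := ltnP i (N + p)%N; first by exists i.
  have [|j Hj Hk] := IH (i - p)%N; first lia.
  exists j => // k; rewrite -Hk -(per (i - p + k)%N); last lia.
  by congr w; lia.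
set n := (N + p)%N.
pose f i := mkseq (fun k => w (i + k)%N) n.
have : (`I_n.+1 #<= `I_n)%card.
  apply: card_le_trans (card_image_le f `I_n).
  apply: (@card_le_trans _ _ _ (factors w n)).
    by have := cn n; rewrite card_eq_le => /andP[].
  apply: subset_card_le => _ [i _ <-]; have [j Hj Hk] := red i.
  by exists j => //; apply: eq_mkseq => k; rewrite Hk.
by rewrite card_le_II ltnn.
Qed.

Section Expansion.
Variables (R : realType) (beta : R) (a b : int).
Hypotheses (beta_gt1 : 1 < beta) (a_ge0 : 0 <= a) (a_lt_b : a < b)
  (sturm : sturmian_over a b (beta_expansion1 beta)).
Let w := beta_expansion1 beta.
Let t i := iter i (beta_map beta) 1.

Definition eps i := beta_expansion1 beta i == b.

Lemma orbit_itv i : 0 <= t i <= 1.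
Proof.
case: i => [|i]; first by rewrite /t /= ler01 lexx.
rewrite /t /= /beta_map; have := floor_itv (beta * iter i (beta_map beta) 1).
by rewrite intrD => /andP[? ?]; apply/andP; split; lra.
Qed.

Lemma orbitS i : t i.+1 = beta * t i - (w i)%:~R.
Proof. by []. Qed.

Lemma digitE i : w i = a + (b - a) * (eps i)%:Z.
Proof.
case: sturm => ab /(_ i)[E|E] _; rewrite /eps /w E; last by rewrite eqxx mulr1 addrC subrK.
by case: eqP => // _; rewrite mulr0 addr0.
Qed.

Lemma eps_eq i j : eps i = eps j -> w i = w j.
Proof. by rewrite !digitE => ->. Qed.

Lemma eps_good : good eps.
Proof.
have [ab _ cn] := sturm.
have occE i j v : occ eps i v -> occ eps j v ->
    mkseq (fun k => w (i + k)%N) (size v) = mkseq (fun k => w (j + k)%N) (size v).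
  move=> Hi Hj; apply/(@eq_from_nth _ 0); rewrite !size_mkseq // => k Hk.
  by rewrite !nth_mkseq //; apply: eps_eq; rewrite (occ_nth Hi) // (occ_nth Hj).
have occ_last i v l : occ eps i (rcons v l) -> eps (i + size v)%N = l.
  by rewrite -cats1 occ_cat /= andbT => /andP[_ /eqP].
have occ_init i v l : occ eps i (rcons v l) -> occ eps i v.
  by rewrite -cats1 occ_cat => /andP[].
have ne i j : eps i = true -> eps j = false -> w i <> w j.
  by rewrite /eps => Hi Hj E; move: Hi Hj; rewrite -/w E => ->.
split.
- move=> v [[i Hi] [i' Hi']] [[j Hj] [j' Hj']].
  have fi := occE _ _ _ (occ_init _ _ _ Hi) (occ_init _ _ _ Hi').
  have fj := occE _ _ _ (occ_init _ _ _ Hj) (occ_init _ _ _ Hj').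
  apply: (factors_two_right_special (cn (size v).+1) (cn (size v).+2) fi fj).
  + move=> /(congr1 (nth 0 ^~ 0%N)); rewrite !nth_mkseq // !addn0.
    move: Hi Hj => /= /andP[/eqP Hi _] /andP[/eqP Hj _]; exact/nesym/ne.
  + by apply: ne; [exact: (occ_last _ _ _ Hi)|exact: (occ_last _ _ _ Hi')].
  + by apply: ne; [exact: (occ_last _ _ _ Hj)|exact: (occ_last _ _ _ Hj')].
- move=> N p p0; have [i Hi Hw] := sturmian_aperiodic N p0 cn.
  by exists i => //; apply/eqP => /eps_eq.
(* Parry's argument: the orbit starts at 1, its largest possible value, and [beta_map] preserves the
   order of points with equal digits. Hence the shifted orbit stays below the original one as long
   as the digits agree. *)
- move=> k n Heq Hk.
  have le i : (i <= n)%N -> t (k + i)%N <= t i.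
    elim: i => [|i IH] Hi; first by rewrite addn0; have /andP[] := orbit_itv k.
    rewrite addnS !orbitS (eps_eq (Heq i Hi)) lerD2r ler_pM2l ?IH ?(ltnW Hi) //.
    exact: lt_trans beta_gt1.
  have : w (k + n)%N <= w n.
    by apply: le_floor; rewrite ler_pM2l ?le //; exact: lt_trans beta_gt1.
  rewrite !digitE Hk; case: (eps n) => //=; lia.
Qed.

(** Truncated expansion of 1: the sum of [w i * z^(i+1)] over [i < n], plus [z^n * t n], is 1. The
    digits are written [a + (b - a) * eps i], and the factor [1 - z] clears the geometric series
    carried by [a]. *)
Lemma eps_sum n : let z := beta^-1 in
  (b - a)%:~R * z * (1 - z) * (\sum_(i < n) (eps i)%:R * z ^+ i)
  = (1 - (1 + a%:~R) * z) - z ^+ n * ((1 - z) * t n - a%:~R * z).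
Proof.
move=> z; have b0 : beta != 0 by rewrite gt_eqF // (lt_trans _ beta_gt1).
have zb : z * beta = 1 by rewrite /z mulVf.
elim: n => [|n IH]; first by rewrite big_ord0 /t /=; ring.
rewrite orbitS digitE big_ord_recr /= mulrDr {}IH exprS !(intrD, intrM).
have -> : (Posz (eps n))%:~R = (eps n)%:R :> R by case: (eps n).
apply/eqP; rewrite -subr_eq0; apply/eqP.
transitivity (z ^+ n * (1 - z) * t n * (z * beta - 1)); last by rewrite zb subrr mulr0.
by ring.
Qed.

End Expansion.

(** * Generating functions of substituted words *)

Section WordSums.
Variable S : comNzRingType.
Implicit Types (u v z : S) (w : seq bool).

Definition monom u v w : S := u ^+ count negb w * v ^+ count id w.

(* The sum of [monom u v p] over the prefixes [p] of [w] that are followed in [w] by [l0]. *)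
Fixpoint wsum (l0 : bool) u v w : S :=
  if w is l :: w' then (l == l0)%:R + (if l then v else u) * wsum l0 u v w' else 0.

Lemma monom_cons u v l w : monom u v (l :: w) = (if l then v else u) * monom u v w.
Proof. by rewrite /monom; case: l; rewrite /= add0n add1n exprS; ring. Qed.

Lemma monom_nil u v : monom u v [::] = 1.
Proof. by rewrite /monom mulr1. Qed.

Lemma monom_cat u v w w' : monom u v (w ++ w') = monom u v w * monom u v w'.
Proof. by rewrite /monom !count_cat !exprD; ring. Qed.

Lemma monom_size z w : monom z z w = z ^+ size w.
Proof.
by elim: w => [|l w IH]; rewrite ?monom_nil // monom_cons IH /= exprS; case: l.
Qed.

Lemma wsum_cat l0 u v w w' : wsum l0 u v (w ++ w') = wsum l0 u v w + monom u v w * wsum l0 u v w'.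
Proof.
elim: w => [|l w IH] /=; first by rewrite monom_nil add0r mul1r.
by rewrite IH monom_cons; ring.
Qed.

(** Each letter contributes the difference of the monomials of two successive prefixes. *)
Lemma wsum_telescope u v w :
  (1 - u) * wsum false u v w + (1 - v) * wsum true u v w = 1 - monom u v w.
Proof.
elim: w => [|l w IH]; first by rewrite /= monom_nil; ring.
have E : monom u v w = 1 - ((1 - u) * wsum false u v w + (1 - v) * wsum true u v w).
  by rewrite IH; ring.
by rewrite monom_cons E; case: l => /=; ring.
Qed.

(** The image of a prefix [p] of [w] shifts the block after it by a power of [z] equal to
    [monom u v p]. *)
Lemma wsum_flatten l0 z (phi : bool -> seq bool) w :
  let u := z ^+ size (phi false) in let v := z ^+ size (phi true) in
  wsum l0 z z (flatten (map phi w)) =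
    wsum l0 z z (phi false) * wsum false u v w + wsum l0 z z (phi true) * wsum true u v w.
Proof.
move=> u v; elim: w => [|l w IH] /=; first by ring.
by rewrite wsum_cat IH monom_size; case: l; rewrite /= -?/u -?/v; ring.
Qed.

Lemma monom_flatten z (phi : bool -> seq bool) w :
  monom z z (flatten (map phi w)) = monom (z ^+ size (phi false)) (z ^+ size (phi true)) w.
Proof.
elim: w => [|l w IH] /=; first by rewrite !monom_nil.
by rewrite monom_cat IH monom_cons monom_size; case: l.
Qed.

End WordSums.

Lemma rmorph_wsum (S S' : comNzRingType) (f : {rmorphism S -> S'}) l0 u v w :
  f (wsum l0 u v w) = wsum l0 (f u) (f v) w.
Proof.
elim: w => [|l w IH] /=; first by rewrite rmorph0.
by rewrite rmorphD rmorphM rmorph_nat IH; case: l.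
Qed.

Definition len d (l : bool) n := size (sig d n [:: l]).

Lemma sigE d n w : sig d n w = flatten (map (fun l => sig d n [:: l]) w).
Proof.
have sig_cat m s t : sig d m (s ++ t) = sig d m s ++ sig d m t.
  by elim: m s t => // m IH s t /=; rewrite sub_cat IH.
elim: w => [|l w IH] /=; last by rewrite -IH -sig_cat.
by elim: n => // n IH /=.
Qed.

Lemma sigS1 d n l : sig d n.+1 [:: l] =
  if l == d n then sig d n [:: l] else sig d n [:: true] ++ sig d n [:: false].
Proof.
rewrite /= /sub /tau /=; case: eqP => [->//|_] /=.
by rewrite [LHS]sigE /= cats0.
Qed.

Lemma lenS d n l : len d l n.+1 = if l == d n then len d l n else (len d true n + len d false n)%N.
Proof. by rewrite /len sigS1; case: eqP; rewrite ?size_cat. Qed.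

Lemma len_gt0 d n l : (0 < len d l n)%N.
Proof. by elim: n l => // n IH l; rewrite lenS; case: eqP => _; rewrite ?IH // addn_gt0 IH. Qed.

(** The column of a letter consists of [1 - z^len] and its word sum. Replacing a letter by 10 is a
    column operation: the determinant is multiplied by [v] if [d n] is true and unchanged otherwise,
    exactly like [u]. *)
Lemma level_det (S : comNzRingType) (z : S) d n :
  let u := z ^+ len d false n in let v := z ^+ len d true n in
  z * ((1 - u) * wsum true z z (sig d n [:: true]) - (1 - v) * wsum true z z (sig d n [:: false]))
  = (1 - z) * u.
Proof.
elim: n => [|n IH] u v; first by rewrite /u /v /len /= expr1; ring.
move: IH; rewrite /u /v !lenS !sigS1; case: (d n) => /= IH.
  rewrite wsum_cat monom_size -/(len _ _ _) exprD.
  by rewrite mulrCA -IH; ring.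
rewrite wsum_cat monom_size -/(len _ _ _) exprD -IH; ring.
Qed.

(** * Values attached to a level and their approximation *)

Section Level.
Variables (R : realType) (z X C0 : R) (x : nat -> bool) (d : nat -> bool).
Hypotheses (z0 : 0 < z) (z1 : z < 1) (C0_ge0 : 0 <= C0).
Hypothesis approxX : forall s, occ x 0 s -> `|X - wsum true z z s| <= C0 * z ^+ size s.

Definition lu n := z ^+ len d false n.
Definition lv n := z ^+ len d true n.
(** The value at [(lu n, lv n)] of the series over the ones of the level [n] word. It comes by
    Cramer's rule from the limits of [wsum_flatten] and [wsum_telescope], with the determinant
    [level_det], so that no infinite sum is involved. *)
Definition lh n := z * ((1 - lu n) * X - wsum true z z (sig d n [:: false])) / ((1 - z) * lu n).

Lemma lu_gt0 n : 0 < lu n. Proof. exact: exprn_gt0. Qed.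
Lemma lv_gt0 n : 0 < lv n. Proof. exact: exprn_gt0. Qed.
Lemma lu_le n : lu n <= z.
Proof. by rewrite /lu -[leRHS]expr1 ler_wiXn2l ?(ltW z0) ?(ltW z1) // len_gt0. Qed.
Lemma lv_le n : lv n <= z.
Proof. by rewrite /lv -[leRHS]expr1 ler_wiXn2l ?(ltW z0) ?(ltW z1) // len_gt0. Qed.

Lemma wsum_ge0 l0 (u v : R) w : 0 <= u -> 0 <= v -> 0 <= wsum l0 u v w.
Proof.
move=> u0 v0; elim: w => //= l w IH; rewrite addr_ge0 ?ler0n // mulr_ge0 //; by case: l.
Qed.

Lemma monom_ge0 (u v : R) w : 0 <= u -> 0 <= v -> 0 <= monom u v w.
Proof. by move=> u0 v0; rewrite mulr_ge0 ?exprn_ge0. Qed.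

Lemma wsum_le (u v : R) w : 0 <= u <= 1 -> 0 <= v -> v < 1 -> wsum true u v w <= (1 - v)^-1.
Proof.
move=> /andP[u0 u1] v0 v1; rewrite -[_^-1]mul1r ler_pdivlMr ?subr_gt0 // mulrC.
have := wsum_telescope u v w; have := monom_ge0 w u0 v0.
have : 0 <= (1 - u) * wsum false u v w by rewrite mulr_ge0 ?wsum_ge0 // subr_ge0.
by lra.
Qed.

Definition approx_const := z * (C0 + (1 - z)^-1) / (1 - z).

Lemma approx_const_ge0 : 0 <= approx_const.
Proof.
have z1' : 0 <= 1 - z by rewrite subr_ge0 ltW.
apply: divr_ge0 => //; apply: mulr_ge0; first exact: ltW.
by rewrite addr_ge0 ?invr_ge0.
Qed.

(** A finite prefix satisfies the same linear system up to the defect [monom] and the error in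
    [approxX], both of order [z ^+ size s]. Cramer's rule divides them by the determinant, whence
    the factor [1 / lu n]. *)
Lemma lh_approx n w : occ x 0 (sig d n w) ->
  `|lh n - wsum true (lu n) (lv n) w| <= approx_const * (monom (lu n) (lv n) w / lu n).
Proof.
move=> /approxX; set s := sig d n w.
have szs : z ^+ size s = monom (lu n) (lv n) w by rewrite -monom_size /s sigE monom_flatten.
rewrite szs; set m := monom _ _ _; set u := lu n; set v := lv n.
have m0 : 0 <= m by rewrite monom_ge0 // ltW // exprn_gt0.
set P := wsum true z z s.
set Pf := wsum true z z (sig d n [:: false]); set Pt := wsum true z z (sig d n [:: true]).
set HT := wsum true u v w; set HF := wsum false u v w.
have PE : P = Pf * HF + Pt * HT by rewrite /P /s sigE wsum_flatten.
have tele : (1 - u) * HF + (1 - v) * HT = 1 - m := wsum_telescope u v w.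
have det : z * ((1 - u) * Pt - (1 - v) * Pf) = (1 - z) * u := level_det z d n.
have u0 : 0 < u := lu_gt0 n.
have uz : u <= z := lu_le n.
have Pf0 : 0 <= Pf by rewrite wsum_ge0 // ltW.
have Pf1 : Pf <= (1 - z)^-1 by rewrite wsum_le // ?(ltW z0) ?(ltW z1).
move=> HX.
have z1' : 0 < 1 - z by rewrite subr_gt0.
have -> : lh n - HT = z * ((1 - u) * (X - P) - Pf * m) / ((1 - z) * u).
  rewrite /lh -/u -/Pf; apply/eqP; rewrite eq_sym -subr_eq0; apply/eqP.
  rewrite opprB addrCA -mulrBl -[HT in HT + _](mulfK (x := (1 - z) * u)) ?mulf_neq0 ?gt_eqF // -mulrDl.
  rewrite -det PE; have -> : m = 1 - ((1 - u) * HF + (1 - v) * HT) by rewrite tele; ring.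
  by apply/eqP; rewrite mulf_eq0; apply/orP; left; apply/eqP; ring.
rewrite normrM normfV (gtr0_norm (x := _ * u)) ?mulr_gt0 // normrM (gtr0_norm z0).
rewrite /approx_const invfM !mulrA ler_pM2r ?invr_gt0 // -!mulrA ler_pM2l // [leRHS]mulrCA [leLHS]mulrC.
rewrite ler_pM2l ?invr_gt0 //.
rewrite -/(monom _ _ _) -/m; apply: le_trans (ler_normB _ _) _; rewrite [leRHS]mulrDl lerD //.
  rewrite normrM ger0_norm; last by lra.
  apply: le_trans HX; rewrite ler_piMl //; lra.
by rewrite normrM !ger0_norm // ler_wpM2r.
Qed.

End Level.

(** * Liouville's inequality *)

Definition L1 (p : {poly int}) : nat := (\sum_(i < size p) absz (p`_i)%R)%N.

Lemma L1_widen (p : {poly int}) n : (size p <= n)%N -> L1 p = (\sum_(i < n) absz (p`_i)%R)%N.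
Proof.
move=> Hn; rewrite /L1 (big_ord_widen n (fun i => absz (p`_i))) // big_mkcond /=.
apply: eq_bigr => i _; case: ltnP => // Hi; by rewrite nth_default.
Qed.

Lemma L1D p q : (L1 (p + q) <= L1 p + L1 q)%N.
Proof.
set n := maxn (size p) (size q).
rewrite (@L1_widen (p + q) n) ?size_polyD // (@L1_widen p n) ?leq_maxl // (@L1_widen q n) ?leq_maxr //.
rewrite -big_split /=; apply: leq_sum => i _; by rewrite coefD -lez_nat PoszD !abszE ler_normD.
Qed.

Lemma L1_sum (I : Type) (r : seq I) (P : pred I) (F : I -> {poly int}) :
  (L1 (\sum_(i <- r | P i) F i) <= \sum_(i <- r | P i) L1 (F i))%N.
Proof.
elim/big_rec2: _ => [|i m p _ IH]; first by rewrite /L1 size_poly0 big_ord0.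
by apply: leq_trans (L1D _ _) _; rewrite leq_add2l.
Qed.

Lemma L1Z c q : (L1 (c *: q) <= `|c| * L1 q)%N.
Proof.
rewrite (@L1_widen _ (size q)) ?size_scale_leq // /L1 big_distrr /=.
by apply: leq_sum => i _; rewrite coefZ abszM.
Qed.

Lemma L1N p : L1 (- p) = L1 p.
Proof. by rewrite /L1 size_polyN; apply: eq_bigr => i _; rewrite coefN abszN. Qed.

Lemma L1MXn q k : L1 (q * 'X^k) = L1 q.
Proof.
have [->|q0] := eqVneq q 0; first by rewrite mul0r.
rewrite /L1 size_mulXn // big_split_ord /= big1 ?add0n => [|i _].
  by apply: eq_bigr => i _; rewrite coefMXn ltnNge leq_addr /= addKn.
by rewrite coefMXn ltn_ord.
Qed.

Lemma L1M p q : (L1 (p * q) <= L1 p * L1 q)%N.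
Proof.
rewrite -{1}(coefK p) poly_def big_distrl /=.
apply: leq_trans (L1_sum _ _ _) _; rewrite /(L1 p) big_distrl /=; apply: leq_sum => i _.
by rewrite -scalerAl; apply: leq_trans (L1Z _ _) _; rewrite mulrC L1MXn.
Qed.

Lemma L1C c : L1 c%:P = `|c|%N.
Proof. by rewrite (@L1_widen _ 1) ?size_polyC_leq1 // big_ord1 coefC. Qed.

Lemma L1Xn n : L1 'X^n = 1%N.
Proof. by rewrite -[X in L1 X]mul1r L1MXn L1C. Qed.

Lemma L1X p n : (L1 (p ^+ n) <= L1 p ^ n)%N.
Proof.
elim: n => [|n IH]; first by rewrite expr0 L1C.
by rewrite exprS expnS; apply: leq_trans (L1M _ _) _; rewrite leq_mul2l IH orbT.
Qed.

Lemma det_le (R : realDomainType) n (A : 'M[R]_n) (M : R) :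
  (forall i j, `|A i j| <= M) -> `|\det A| <= n`!%:R * M ^+ n.
Proof.
move=> HA; apply: le_trans (ler_norm_sum _ _ _) _.
have -> : n`!%:R * M ^+ n = \sum_(s : 'S_n) M ^+ n :> R.
  by rewrite sumr_const card_Sn mulr_natl.
apply: ler_sum => s _; rewrite normrM normrX normrN1 expr1n mul1r normr_prod.
rewrite -[X in M ^+ X]card_ord -prodr_const; apply: ler_prod => i _.
by rewrite normr_ge0 HA.
Qed.

Section Liouville.
Variables (R : realType) (z : R).

Definition ieval (p : {poly int}) : R := (map_poly intr p).[z].

Fact ieval_zmod : zmod_morphism ieval.
Proof. by move=> p q; rewrite /ieval rmorphB hornerD hornerN. Qed.
Fact ieval_monoid : monoid_morphism ieval.
Proof. by split=> [|p q]; rewrite /ieval ?rmorph1 ?hornerC // rmorphM hornerM. Qed.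
HB.instance Definition _ := GRing.isZmodMorphism.Build {poly int} R ieval ieval_zmod.
HB.instance Definition _ := GRing.isMonoidMorphism.Build {poly int} R ieval ieval_monoid.

Lemma ievalX n : ieval 'X^n = z ^+ n.
Proof. by rewrite /ieval map_polyXn hornerXn. Qed.

Lemma ievalC c : ieval c%:P = c%:~R.
Proof. by rewrite /ieval map_polyC hornerC. Qed.

Lemma ievalE n (p : {poly int}) : (size p <= n)%N -> ieval p = \sum_(i < n) (p`_i)%:~R * z ^+ i.
Proof.
move=> Hn; rewrite /ieval (@horner_coef_wide _ n) ?(leq_trans (size_poly _ _)) //.
by apply: eq_bigr => i _; rewrite coef_map.
Qed.

Lemma rat_poly_root_int (q : {poly rat}) : q != 0 -> root (map_poly ratr q) z ->
  exists p : {poly int}, [/\ p != 0, ieval p = 0 & size p = size q].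
Proof.
move=> q0 /rootP Hq; have [p [a a0 E]] := rat_poly_scale q.
have a0' : a%:~R != 0 :> rat by rewrite intr_eq0.
exists p; split.
- by apply: contraNneq q0 => p0; rewrite E p0 map_poly0 scaler0.
- move: Hq; rewrite E map_polyZ hornerZ -map_poly_comp => /eqP; rewrite mulf_eq0 => /orP[|].
    by rewrite fmorph_eq0 invr_eq0 (negbTE a0').
  move=> /eqP <-; rewrite /ieval; congr (_.[z]); apply: eq_map_poly => c /=.
  by rewrite ratr_int.
- by rewrite E size_scale ?invr_eq0 // size_map_inj_poly //; exact: intr_inj.
Qed.

(* The rows of the integer matrix [N] expand [g^(D+m) z^j Q(z)] in the powers of [z]; its
   determinant is nonzero by minimality of the degree of [p], hence at least 1. *)
Theorem liouville : algebraicOver (ratr : rat -> R) z ->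
  exists C e, 1 <= C /\ forall D (Q : {poly int}), (size Q <= D)%N -> ieval Q != 0 ->
    1 <= `|ieval Q| * C ^+ D * (L1 Q)%:R ^+ e.
Proof.
move=> [pz0 pz0_neq0 pz0_root].
have alg : exists2 p, p != 0 & ieval p = 0.
  by have [p [? ? _]] := rat_poly_root_int pz0_neq0 pz0_root; exists p.
pose P n := `[< exists p : {poly int}, [/\ p != 0, ieval p = 0 & size p = n] >].
have exP : exists n, P n by have [p p0 pz] := alg; exists (size p); apply/asboolP; exists p.
have [_ /asboolP[p [p0 pz <-]] pmin] := ex_minnP exP.
have minp (q : {poly int}) : q != 0 -> ieval q = 0 -> (size p <= size q)%N.
  by move=> q0 qz; apply: pmin; apply/asboolP; exists q.
have sp1 : (1 < size p)%N.
  rewrite ltnNge; apply/negP => /size1_polyC E; move: pz p0; rewrite E ievalC => /eqP.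
  by rewrite intr_eq0 polyC_eq0 => ->.
(* The degree of [p] is [m.+1], so the powers of [z] up to [z^m] are independent over the
   rationals. *)
pose m := (size p).-2; have spm : size p = m.+2 by rewrite /m; case: (size p) sp1 => [|[]].
pose g := lead_coef p; have gE : g = p`_m.+1 by rewrite /g lead_coefE spm.
have g0 : g != 0 by rewrite lead_coef_eq0.
pose B : nat := (2 * L1 p)%N.
have cpB i : (absz (p`_i)%R <= L1 p)%N.
  have [Hi|Hi] := ltnP i (size p); last by rewrite nth_default.
  by rewrite /L1 (bigD1 (Ordinal Hi)) //= leq_addr.
have gL : (absz g <= L1 p)%N by rewrite gE; exact: cpB.
have ag0 : (0 < absz g)%N by rewrite absz_gt0.
have B0 : (0 < B)%N by rewrite /B; lia.
have redz : g%:~R * z ^+ m.+1 = - \sum_(i < m.+1) (p`_i)%:~R * z ^+ i :> R.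
  by apply/eqP; rewrite -addr_eq0 addrC -[X in _ == X]pz (@ievalE m.+2) ?spm // [X in _ == X]big_ord_recr /= -gE.
(* Reduction by [redz]: the leading coefficient [g] in each factor keeps the coefficients integral,
   and each step enlarges them by at most [B], twice the norm of [p]. *)
have red k : exists c : nat -> int, (forall i, (absz (c i) <= B ^ k)%N) /\
    (g%:~R * z) ^+ k = \sum_(i < m.+1) (c i)%:~R * z ^+ i.
  elim: k => [|k [c [cB cE]]].
    exists (fun i => (i == 0%N)%:Z); split=> [[]//|].
    by rewrite big_ord_recl big1 ?addr0 ?mulr1 // => i _; rewrite mul0r.
  exists (fun i => (if i is j.+1 then g * c j else 0) - c m * p`_i); split=> [i|].
    have H1 : (absz (c m * p`_i)%R <= B ^ k * L1 p)%N by rewrite abszM leq_mul.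
    have H2 : (absz (if i is j.+1 then g * c j else 0)%R <= L1 p * B ^ k)%N.
      by case: i {H1} => [|j] //; rewrite abszM leq_mul.
    have tri (x y : int) : (absz (x - y)%R <= absz x + absz y)%N by lia.
    apply: leq_trans (tri _ _) _; rewrite expnSr /B mulnCA mul2n -addnn.
    by rewrite leq_add // mulnC.
  under eq_bigr => i _ do rewrite intrB mulrBl.
  rewrite big_split /= sumrN.
  under [X in _ - X]eq_bigr => i _ do rewrite intrM -mulrA.
  rewrite -mulr_sumr -mulrN -redz big_ord_recl /= mul0r add0r exprSr cE mulr_suml big_ord_recr /=.
  congr (_ + _); last by rewrite exprS; ring.
  by apply: eq_bigr => i _; rewrite /= intrM exprS; ring.
have [c cB cE] : exists2 c : nat -> nat -> int, (forall k i, (absz (c k i) <= B ^ k)%N) &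
    forall k, (g%:~R * z) ^+ k = \sum_(i < m.+1) (c k i)%:~R * z ^+ i.
  by have [c Hc] := choice red; exists c => k; have [] := Hc k.
pose Z := Num.max 1 `|z|.
have Z1 : 1 <= Z by rewrite le_max lexx.
pose C : R := (m.+1 * m`! * B ^ (m.+2 * m.+1))%N%:R * Z ^+ m.
have B1 : 1 <= B%:R :> R by rewrite ler1n.
have C_ge1 : 1 <= C.
  rewrite /C -[leLHS]mulr1 ler_pM ?ler01 ?exprn_ege1 //.
  by rewrite ler1n !muln_gt0 fact_gt0 expn_gt0 B0.
exists C, m; split=> // D Q sQ Qz.
have D0 : (0 < D)%N.
  apply: leq_trans sQ; rewrite lt0n size_poly_eq0; by apply: contraNneq Qz => ->; rewrite rmorph0.
pose T := (D + m)%N.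
pose N : 'M[int]_m.+1 :=
  \matrix_(j, i) \sum_(k < D) Q`_k * g ^+ (T - (j + k)) * c (j + k)%N i.
have NE (j : 'I_m.+1) : \sum_i (N j i)%:~R * z ^+ i = g%:~R ^+ T * ieval Q * z ^+ j :> R.
  under eq_bigr => i _ do rewrite mxE rmorph_sum /= mulr_suml.
  rewrite exchange_big /= (ievalE sQ) mulr_sumr mulr_suml; apply: eq_bigr => k _.
  under eq_bigr => i _ do rewrite !intrM -mulrA.
  rewrite -mulr_sumr -cE rmorphXn /= exprMn.
  have HT : (j + k <= T)%N by rewrite /T; have := ltn_ord k; have := ltn_ord j; lia.
  rewrite -{2}(subnK HT) !exprD; ring.
pose M : nat := (L1 Q * B ^ T)%N.
have NM i j : (absz (N i j) <= M)%N.
  rewrite mxE /M (L1_widen sQ) big_distrl /=.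
  apply: (@leq_trans (\sum_(k < D) absz (Q`_k * g ^+ (T - (i + k)) * c (i + k)%N j)%R)%N).
    elim/big_rec2: _ => //= k y1 y2 _; lia.
  apply: leq_sum => k _; rewrite !abszM abszX -mulnA leq_mul2l; apply/orP; right.
  have HT : (i + k <= T)%N by rewrite /T; have := ltn_ord k; have := ltn_ord i; lia.
  rewrite -{2}(subnK HT) expnD leq_mul //.
  have gB : (absz g <= B)%N by rewrite /B; lia.
  by elim: (T - (i + k))%N => // e IH; rewrite !expnS leq_mul.
have detN : \det N != 0.
  apply/eqP => d0.
  have /eqP/det0P[r r0 rN] : \det (map_mx (intr : int -> rat) N) = 0 by rewrite det_map_mx d0.
  have q0' : rVpoly r != 0.
    by apply: contraNneq r0 => E; rewrite -(rVpolyK r) E linear0.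
  have qE : (map_poly ratr (rVpoly r)).[z] = \sum_(j < m.+1) ratr (r 0 j) * z ^+ j.
    rewrite (@horner_coef_wide _ m.+1); last by rewrite size_map_poly size_poly.
    by apply: eq_bigr => j _; rewrite coef_map coef_rVpoly_ord.
  have S0 : g%:~R ^+ T * ieval Q * \sum_(j < m.+1) ratr (r 0 j) * z ^+ j = 0 :> R.
    rewrite mulr_sumr.
    transitivity (\sum_(j < m.+1) ratr (r 0 j) * \sum_i (N j i)%:~R * z ^+ i : R).
      by apply: eq_bigr => j _; rewrite NE; ring.
    under eq_bigr => j _ do rewrite mulr_sumr.
    rewrite exchange_big big1 //= => i _.
    under eq_bigr => j _ do rewrite mulrA.
    rewrite -mulr_suml; apply/eqP; rewrite mulf_eq0; apply/orP; left; apply/eqP.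
    have := congr1 (fun A : 'rV[rat]_m.+1 => ratr (A 0 i) : R) rN; rewrite mxE [(0 : 'M__) _ _]mxE raddf0 => E0; rewrite -[RHS]E0.
    rewrite rmorph_sum; apply: eq_bigr => j _; rewrite rmorphM /=.
    by rewrite [map_mx _ _ _ _]mxE ratr_int.
  have gT : g%:~R ^+ T * ieval Q != 0 :> R by rewrite mulf_neq0 // expf_neq0 // intr_eq0.
  move: S0 => /eqP; rewrite mulf_eq0 (negbTE gT) /= -qE => /eqP/rootP Hr.
  have [p' [p'0 p'z sp']] := rat_poly_root_int q0' Hr.
  by have := minp _ p'0 p'z; rewrite spm sp' ltnNge size_poly.
(* Row 0 of [\adj N *m N], applied to the powers of [z], is [\det N]. The value of [Q] factors out
   of it, and the cofactors are bounded through the entries of [N]. *)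
have detE : (\det N)%:~R = g%:~R ^+ T * ieval Q * \sum_(k < m.+1) (\adj N 0 k)%:~R * z ^+ k :> R.
  transitivity (\sum_(i < m.+1) ((\adj N *m N) 0 i)%:~R * z ^+ i : R).
    rewrite mul_adj_mx big_ord_recl big1 ?addr0 => [|i _]; last by rewrite mxE mul0r.
    by rewrite mxE mulr1.
  under eq_bigr => i _ do rewrite mxE rmorph_sum /= mulr_suml.
  rewrite exchange_big mulr_sumr /=; apply: eq_bigr => k _.
  under eq_bigr => i _ do rewrite intrM -mulrA.
  by rewrite -mulr_sumr NE; ring.
have adjM k : `|(\adj N 0 k)%:~R| <= (m`! * M ^ m)%N%:R :> R.
  rewrite mxE /cofactor intrM normrM rmorphXn /= rmorphN1 normrX normrN1 expr1n mul1r.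
  rewrite natrM natrX -det_map_mx; apply: det_le => i j; rewrite 3!mxE.
  by rewrite -intr_norm -abszE -pmulrn ler_nat NM.
have gB : `|g%:~R| <= B%:R :> R.
  by rewrite -intr_norm -abszE -pmulrn ler_nat /B; lia.
have : 1 <= `|(\det N)%:~R| :> R.
  by rewrite -intr_norm -abszE -pmulrn ler1n absz_gt0.
move=> /le_trans; apply; rewrite {}detE !normrM normrX.
rewrite [leLHS]mulrAC -[leRHS]mulrA [leLHS]mulrC ler_wpM2l //.
apply: (@le_trans _ _ (B%:R ^+ T * (m.+1%:R * ((m`! * M ^ m)%N%:R * Z ^+ m)))).
  rewrite ler_pM ?exprn_ge0 ?lerXn2r ?nnegrE //; apply: le_trans (ler_norm_sum _ _ _) _.
  rewrite -[X in X%:R * _]card_ord mulr_natl -sumr_const; apply: ler_sum => k _.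
  rewrite normrM normrX ler_pM ?exprn_ge0 //.
  apply: (@le_trans _ _ (Z ^+ k)); first by rewrite lerXn2r ?nnegrE ?le_max ?lexx ?orbT // (le_trans ler01).
  by rewrite ler_weXn2l // -ltnS.
pose K : R := (m.+1 * m`!)%N%:R * Z ^+ m.
have K1 : 1 <= K.
  rewrite /K -[leLHS]mulr1 ler_pM ?ler01 ?exprn_ege1 //.
  by rewrite ler1n !muln_gt0 fact_gt0.
have CE : C ^+ D = K ^+ D * B%:R ^+ (m.+2 * m.+1 * D).
  have -> : C = K * B%:R ^+ (m.+2 * m.+1) by rewrite /C /K natrM natrX; ring.
  by rewrite exprMn -exprM.
rewrite CE; set b := B%:R.
have -> : b ^+ T * (m.+1%:R * ((m`! * M ^ m)%N%:R * Z ^+ m)) =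
    K * b ^+ (T + T * m) * (L1 Q)%:R ^+ m.
  by rewrite /K /M !natrM natrX natrM natrX -/b exprMn exprD exprM; ring.
rewrite ler_wpM2r ?exprn_ge0 // ler_pM ?exprn_ge0 ?(le_trans ler01 K1) //.
  by rewrite -[leLHS]expr1 ler_weXn2l.
by rewrite ler_weXn2l // /T; nia.
Qed.

End Liouville.

(** * Lower bound for polynomial values at a level *)

Definition cube m := ('I_m * 'I_m * 'I_m)%type.

Definition peval (S : comNzRingType) m (c : cube m -> int) (u v h : S) : S :=
  \sum_(t : cube m) (c t)%:~R * (u ^+ t.1.1 * v ^+ t.1.2 * h ^+ t.2).

Definition dle k (p : {poly int}) := (size p <= k.+1)%N.

Lemma dleM k l p q : dle k p -> dle l q -> dle (k + l) (p * q).
Proof. rewrite /dle => Hp Hq; apply: leq_trans (size_polyMleq _ _) _; lia. Qed.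

Lemma dleX k p n : dle k p -> dle (k * n) (p ^+ n).
Proof.
move=> Hp; elim: n => [|n IH]; first by rewrite muln0 expr0 /dle size_poly1.
by rewrite exprS mulnS; apply: dleM.
Qed.

Lemma dleD k p q : dle k p -> dle k q -> dle k (p + q).
Proof. by move=> Hp Hq; apply: leq_trans (size_polyD _ _) _; rewrite geq_max; apply/andP. Qed.

Lemma dleN k p : dle k p -> dle k (- p).
Proof. by rewrite /dle size_polyN. Qed.

Lemma dleW k l p : (k <= l)%N -> dle k p -> dle l p.
Proof. by move=> Hkl Hp; apply: leq_trans Hp _. Qed.

Lemma dleC k c : dle k c%:P.
Proof. exact: leq_trans (size_polyC_leq1 _) _. Qed.

Lemma dleXn n : dle n 'X^n.
Proof. by rewrite /dle size_polyXn. Qed.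

Lemma dle_wsum w : dle (size w) (wsum true 'X 'X w).
Proof.
elim: w => [|l w IH] /=; first exact: (dleC _ 0).
apply: dleD; first by case: l; [exact: (dleC _ 1)|exact: (dleC _ 0)].
by rewrite if_same -[(size w).+1]add1n; apply: dleM => //; exact: (dleXn 1).
Qed.

Lemma L1MX q : L1 (q * 'X) = L1 q.
Proof. by rewrite -(L1MXn q 1). Qed.

Lemma L1_wsum w : (L1 (wsum true 'X 'X w) <= size w)%N.
Proof.
elim: w => [|l w IH] /=; first by rewrite (L1C 0).
apply: leq_trans (L1D _ _) _; rewrite if_same mulrC L1MX -add1n leq_add //.
by case: l; rewrite /= ?(L1C 1) ?(L1C 0).
Qed.

Section Key.
Variables (R : realType) (z X : R) (a b : int) (d : nat -> bool).
Hypotheses (z0 : 0 < z) (z1 : z < 1) (ab : a < b).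
Hypothesis alg : algebraicOver (ratr : rat -> R) z.
Hypothesis XE : (b - a)%:~R * z * (1 - z) * X = 1 - (1 + a%:~R) * z.

Definition lsum n := (len d false n + len d true n)%N.

(** Multiplication by [den ^+ m] turns [P] into the value at [z] of an integer polynomial [Q] of
    degree below [4 * (m * l)] and norm at most [Lc * (c0 * 2 ^ l) ^ m], to which [liouville]
    applies. The coefficients [c] enter [A] only, so [B] depends neither on them nor on [m]. *)
Lemma key_lower_bound : exists B : R, 1 <= B /\ forall m (c : cube m -> int), (0 < m)%N ->
  exists A : R, 0 < A /\ forall n, let P := peval c (lu z d n) (lv z d n) (lh z X d n) in
    P != 0 -> 1 <= `|P| * A * B ^+ (m * lsum n).
Proof.
have [C [e [C1 HC]]] := liouville alg.
pose c0 : nat := (2 * (1 + absz (1 + a)%R) + 4 * absz (b - a)%R)%N.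
have ba1 : 1 <= (b - a)%:~R :> R by rewrite -[1]/(1%:~R) ler_int; lia.
have c01 : (1 <= c0)%N by rewrite /c0; lia.
exists (C ^+ 4 * (2 * c0)%N%:R ^+ e); split.
  by rewrite -[leLHS]mulr1 ler_pM ?ler01 ?exprn_ege1 // ler1n; lia.
move=> m c m0.
pose Lc : nat := (\sum_t absz (c t)).+1.
exists ((b - a)%:~R ^+ m * Lc%:R ^+ e); split.
  by rewrite mulr_gt0 // exprn_gt0 ?ltr0n // (lt_le_trans ltr01).
move=> n /=; set u := lu z d n; set v := lv z d n; set h := lh z X d n.
set P := peval c u v h => P0.
set lA := len d false n; set lB := len d true n; set l := lsum n.
have lA0 : (0 < lA)%N := len_gt0 _ _ _; have lB0 : (0 < lB)%N := len_gt0 _ _ _.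
have lE : l = (lA + lB)%N by [].
pose Pf : {poly int} := wsum true 'X 'X (sig d n [:: false]).
(* [Rp] and [Dp] are a numerator and a denominator of [h], obtained by inserting [XE] into [lh]. One
   factor [1 - z] of [Dp] comes from [lh], the other from [XE]. *)
pose Rp : {poly int} := (1 - 'X^lA) * (1 - (1 + a)%:P * 'X) - (b - a)%:P * ('X * (1 - 'X)) * Pf.
pose Dp : {poly int} := (b - a)%:P * (1 - 'X) ^+ 2 * 'X^lA.
pose Q : {poly int} := \sum_(t : cube m)
  (c t)%:P * ('X^lA ^+ t.1.1 * 'X^lB ^+ t.1.2 * Rp ^+ t.2 * Dp ^+ (m - t.2)).
pose den := (b - a)%:~R * (1 - z) ^+ 2 * u.
have u0 : 0 < u by exact: lu_gt0.
have z1' : 0 < 1 - z by rewrite subr_gt0.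
have z1'' : 1 - z <= 1 by rewrite gerBl ltW.
have den0 : 0 < den by rewrite !mulr_gt0 ?exprn_gt0 // (lt_le_trans ltr01).
have evX : ieval z 'X = z by rewrite -['X]expr1 ievalX.
have evD : ieval z Dp = den by rewrite !(rmorphM (ieval z)) !(rmorphXn (ieval z)) (rmorphB (ieval z)) rmorph1 /= ievalC evX.
have evR : ieval z Rp = den * h.
  rewrite !(rmorphB (ieval z), rmorphM (ieval z), rmorph1 (ieval z)) /= ievalX !ievalC evX.
  rewrite (rmorph_wsum (ieval z)) /= evX.
  rewrite /den /h /lh -/u; set pf := wsum _ _ _ _.
  have -> : (b - a)%:~R * (1 - z) ^+ 2 * u * (z * ((1 - u) * X - pf) / ((1 - z) * u)) =
     (1 - u) * ((b - a)%:~R * z * (1 - z) * X) - (b - a)%:~R * z * (1 - z) * pf.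
    by field; rewrite !gt_eqF.
  by rewrite XE intrD /u /lu -/lA; ring.
have evQ : ieval z Q = den ^+ m * P.
  rewrite rmorph_sum /P /peval mulr_sumr; apply: eq_bigr => t _.
  rewrite -!exprM 4!(rmorphM (ieval z)) 4!(rmorphXn (ieval z)) /= evX ievalC evD evR !exprM.
  rewrite -[in X in _ = X * _](subnK (ltnW (ltn_ord t.2))) exprD exprMn -/lA -/lB.
  by rewrite /u /v /lu /lv; ring.
have dR : dle (lA + 2) Rp.
  have d1 : dle 1 (1 - 'X) by apply: dleD; [exact: (dleC _ 1)|exact/dleN/(dleXn 1)].
  apply: dleD; last apply: dleN.
    apply: (@dleW (lA + 1)); first by rewrite leq_add2l.
    apply: dleM; apply: dleD; try exact: (dleC _ 1); apply: dleN; first exact: dleXn.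
    by rewrite -[1%N]add0n; apply: dleM; [exact: dleC|exact: (dleXn 1)].
  rewrite addnC -[2%N]/(0 + (1 + 1))%N; apply: dleM; last exact: dle_wsum.
  by apply: dleM; [exact: dleC|apply: dleM => //; exact: (dleXn 1)].
have dD : dle (lA + 2) Dp.
  have d1 : dle 1 (1 - 'X) by apply: dleD; [exact: (dleC _ 1)|exact/dleN/(dleXn 1)].
  rewrite addnC -[2%N]/(0 + 1 * 2)%N; apply: dleM; last exact: dleXn.
  by apply: dleM; [exact: dleC|exact: dleX].
have dQ : (size Q <= 4 * (m * l))%N.
  apply: (@leq_trans (3 * (m * l)).+1).
    2: by rewrite lE; move: m0 lA0; clear; nia.
  rewrite /Q; elim/big_rec: _ => [|t p _ Hp]; first by rewrite size_poly0.
  apply: dleD => //.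
  apply: (@dleW (0 + (lA * t.1.1 + lB * t.1.2 + (lA + 2) * t.2 + (lA + 2) * (m - t.2)))).
    have := ltn_ord t.1.1; have := ltn_ord t.1.2; have := ltn_ord t.2; move: (m - t.2)%N (subnK (ltnW (ltn_ord t.2))) => r Hr.
    rewrite lE => H1 H2 H3.
    have : (lA * t.1.1 <= lA * m)%N by rewrite leq_mul2l (ltnW H3) orbT.
    have : (lB * t.1.2 <= lB * m)%N by rewrite leq_mul2l (ltnW H2) orbT.
    have E : ((lA + 2) * t.2 + (lA + 2) * r = (lA + 2) * m)%N by rewrite -mulnDr [(t.2 + r)%N]addnC Hr.
    have : ((lA + 2) * m <= 2 * (lA + lB) * m)%N by rewrite leq_mul2r; apply/orP; right; move: lB0 lA0; clear; lia.
    rewrite add0n -addnA E; move: (lA * t.1.1)%N (lB * t.1.2)%N ((lA + 2) * m)%N => r1 r2 r3; clear; nia.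
  apply: dleM; first exact: dleC.
  do 2![apply: dleM; last exact: dleX].
  by apply: dleM; apply: dleX; exact: dleXn.
have l2 : (l < 2 ^ l)%N by exact: ltn_expl.
have L1s : (L1 (1 - 'X) <= 2)%N.
  by apply: leq_trans (L1D _ _) _; rewrite L1N (L1C 1) (L1Xn 1).
(* The norm is linear in [l]; weakening [l] to [2 ^ l] lets its [m]-th power be absorbed by
   [B ^+ (m * l)]. *)
have LR : (L1 Rp <= c0 * 2 ^ l)%N.
  apply: (@leq_trans (c0 * l)); last by rewrite leq_mul2l (ltnW l2) orbT.
  apply: leq_trans (L1D _ _) _; rewrite L1N.
  have H1 : (L1 ((1 - 'X^lA) * (1 - (1 + a)%:P * 'X)) <= 2 * (1 + absz (1 + a)%R))%N.
    apply: leq_trans (L1M _ _) _; apply: leq_mul; apply: leq_trans (L1D _ _) _; rewrite L1N (L1C 1).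
      by rewrite L1Xn.
    by rewrite leq_add2l L1MX L1C.
  have H2 : (L1 ((b - a)%:P * ('X * (1 - 'X)) * Pf) <= absz (b - a)%R * 2 * lA)%N.
    apply: leq_trans (L1M _ _) _; apply: leq_mul; last exact: L1_wsum.
    apply: leq_trans (L1M _ _) _; rewrite L1C leq_mul2l; apply/orP; right.
    by rewrite mulrC L1MX.
  apply: leq_trans (leq_add H1 H2) _; rewrite /c0 lE; move: lA0 lB0; clear; nia.
have LD : (L1 Dp <= c0 * 2 ^ l)%N.
  rewrite L1MXn; apply: leq_trans (L1M _ _) _; rewrite L1C.
  apply: (@leq_trans (absz (b - a)%R * 4)).
    by rewrite leq_mul2l; apply/orP; right; apply: leq_trans (L1M _ _) _; exact: (leq_mul L1s L1s).
  by apply: (@leq_trans c0); [rewrite /c0; clear; lia|rewrite leq_pmulr // expn_gt0].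
have LQ : (L1 Q <= Lc * (c0 * 2 ^ l) ^ m)%N.
  apply: leq_trans (L1_sum _ _ _) _; rewrite /Lc mulSn; apply: leq_trans (leq_addl _ _).
  rewrite big_distrl /=; apply: leq_sum => t _.
  apply: leq_trans (L1M _ _) _; rewrite L1C leq_mul2l; apply/orP; right.
  have pw (e1 e2 : nat) p : (L1 p <= e1)%N -> (L1 (p ^+ e2) <= e1 ^ e2)%N.
    move=> H; apply: leq_trans (L1X _ _) _; elim: e2 => // e2 IH; by rewrite !expnS leq_mul.
  apply: (@leq_trans (1 * 1 * (c0 * 2 ^ l) ^ t.2 * (c0 * 2 ^ l) ^ (m - t.2))).
    apply: leq_trans (L1M _ _) _; apply: leq_mul; last exact: pw.
    apply: leq_trans (L1M _ _) _; apply: leq_mul; last exact: pw.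
    by apply: leq_trans (L1M _ _) _; rewrite -!exprM !L1Xn.
  by rewrite !mul1n -expnD subnKC // ltnW.
have Q0 : ieval z Q != 0 by rewrite evQ mulf_neq0 // expf_neq0 // gt_eqF.
apply: le_trans (HC _ _ dQ Q0) _; rewrite evQ normrM normrX (gtr0_norm den0).
have -> : den ^+ m * `|P| * C ^+ (4 * (m * l)) * (L1 Q)%:R ^+ e =
  `|P| * (den ^+ m * C ^+ (4 * (m * l)) * (L1 Q)%:R ^+ e) by ring.
rewrite -[leRHS]mulrA ler_wpM2l //.
have denb : den <= (b - a)%:~R.
  have u1 : u <= 1 by apply: le_trans (lu_le d z0 z1 n) (ltW z1).
  rewrite /den -mulrA ler_piMr ?(le_trans ler01 ba1) //.
  by apply: mulr_ile1; rewrite ?(ltW u0) ?u1 ?exprn_ge0 ?exprn_ile1 ?(ltW z1') ?(ltW z0) ?(ltW z1).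
apply: (@le_trans _ _ ((b - a)%:~R ^+ m * C ^+ (4 * (m * l)) * (Lc * (c0 * 2 ^ l) ^ m)%N%:R ^+ e)).
  have C0 : 0 <= C by exact: le_trans ler01 C1.
  rewrite ler_pM ?mulr_ge0 ?exprn_ge0 ?(ltW den0) //.
    by rewrite ler_wpM2r ?exprn_ge0 // lerXn2r ?nnegrE ?(ltW den0) ?(le_trans ler01 ba1).
  by rewrite lerXn2r ?nnegrE // ler_nat.
rewrite natrM exprMn [C ^+ (4 * _)]exprM [(C ^+ 4 * _) ^+ (m * l)]exprMn.
have -> : (b - a)%:~R ^+ m * (C ^+ 4) ^+ (m * l) * (Lc%:R ^+ e * ((c0 * 2 ^ l) ^ m)%N%:R ^+ e) =
   (b - a)%:~R ^+ m * Lc%:R ^+ e * ((C ^+ 4) ^+ (m * l) * ((c0 * 2 ^ l) ^ m)%N%:R ^+ e) :> R by ring.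
have C0 : 0 <= C by exact: le_trans ler01 C1.
rewrite ler_wpM2l ?mulr_ge0 ?exprn_ge0 ?(le_trans ler01 ba1) // ler_wpM2l ?exprn_ge0 //.
rewrite exprAC lerXn2r ?nnegrE ?exprn_ge0 //.
rewrite -natrX ler_nat [(m * l)%N]mulnC expnM.
have H : (c0 * 2 ^ l <= (2 * c0) ^ l)%N.
  rewrite expnMn mulnC leq_mul2l; apply/orP; right.
  by rewrite -[leqLHS]expn1 leq_pexp2l // lE addn_gt0 lA0.
by elim: (m) => // k IH; rewrite !expnS leq_mul.
Qed.

End Key.

(** * Unbounded runs *)

Lemma exprn_small (R : realType) (z e : R) : 0 < z -> z < 1 -> 0 < e ->
  exists r0, forall r, (r0 <= r)%N -> z ^+ r < e.
Proof.
move=> z0 z1 e0; pose y := z^-1 - 1.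
have y0 : 0 < y by rewrite subr_gt0 invf_gt1.
have bern r : 1 + r%:R * y <= z^-1 ^+ r.
  elim: r => [|r IH]; first by rewrite mul0r addr0.
  rewrite exprS; apply: (@le_trans _ _ (z^-1 * (1 + r%:R * y))).
    have -> : z^-1 = 1 + y by rewrite /y addrC subrK.
    have : 0 <= r%:R * (y * y) by rewrite mulr_ge0 // mulr_ge0 // ltW.
    by rewrite -natr1; lra.
  by rewrite ler_pM2l // invr_gt0.
exists (Num.bound (e^-1 / y)) => r Hr.
have H : e^-1 < z^-1 ^+ r.
  apply: lt_le_trans (bern r); apply: (@lt_le_trans _ _ (r%:R * y)); last by rewrite lerDr.
  rewrite -ltr_pdivrMr //; apply: lt_le_trans (archi_boundP _) _; last by rewrite ler_nat.
  by rewrite divr_ge0 ?invr_ge0 ?ltW.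
by move: H; rewrite exprVn ltf_pV2 // posrE ?exprn_gt0.
Qed.

Lemma big_cube2 (V : nmodType) (F : cube 2 -> V) : let o := ord0 : 'I_2 in let i := ord_max : 'I_2 in
  \sum_(t : cube 2) F t = F (o, o, o) + F (o, o, i) + (F (o, i, o) + F (o, i, i)) +
    (F (i, o, o) + F (i, o, i) + (F (i, i, o) + F (i, i, i))).
Proof.
move=> o i.
have two (G : 'I_2 -> V) : \sum_(k < 2) G k = G o + G i.
  by rewrite big_ord_recl big_ord1; congr (_ + G _); apply/val_inj.
rewrite (eq_bigr (fun t : cube 2 => F (t.1, t.2))) => [|[] //].
rewrite -(pair_bigA _ (fun p k => F (p, k))) /=.
rewrite (eq_bigr (fun p : 'I_2 * 'I_2 => \sum_(k < 2) F (p.1, p.2, k))) => [|[] //].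
rewrite -(pair_bigA _ (fun p q => \sum_(k < 2) F (p, q, k))) /=.
by rewrite !two.
Qed.

Section Runs.
Variables (R : realType) (z X C0 : R) (a b : int) (W : nat -> nat -> bool) (d : nat -> bool).
Hypotheses (z0 : 0 < z) (z1 : z < 1) (ab : a < b) (C0_ge0 : 0 <= C0).
Hypothesis alg : algebraicOver (ratr : rat -> R) z.
Hypothesis XE : (b - a)%:~R * z * (1 - z) * X = 1 - (1 + a%:~R) * z.
Hypothesis approxX : forall s, occ (W 0) 0 s -> `|X - wsum true z z s| <= C0 * z ^+ size s.
Hypothesis dW : directive W d.

Local Notation u n := (lu z d n).
Local Notation v n := (lv z d n).
Local Notation h n := (lh z X d n).
Local Notation C1 := (approx_const z C0).

Lemma level_approx n w : occ (W n) 0 w ->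
  `|h n - wsum true (u n) (v n) w| <= C1 * (monom (u n) (v n) w / u n).
Proof.
move=> Hw; apply: (@lh_approx _ _ _ _ (W 0)) => //.
exact: (@directive_sig _ _ dW 0 n).
Qed.

Lemma occ_mkseq (y : nat -> bool) m : occ y 0 (mkseq y m).
Proof.
by elim: m => // m IH; rewrite mkseqS -cats1 occ_cat IH size_mkseq /= add0n eqxx.
Qed.

Lemma wsum_lower l0 n i m : W n i = l0 -> (i < m)%N ->
  wsum l0 (u n) (v n) (mkseq (W n) i) + monom (u n) (v n) (mkseq (W n) i)
  <= wsum l0 (u n) (v n) (mkseq (W n) m).
Proof.
move=> Wi Him; have u0 := lu_gt0 d z0 n; have v0 := lv_gt0 d z0 n.
have -> : mkseq (W n) m = mkseq (W n) i ++ W n i :: map (W n) (iota i.+1 (m - i.+1)).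
  by rewrite -{1}(subnKC Him) /mkseq addSnnS iotaD map_cat.
rewrite wsum_cat /= Wi eqxx mulrDr mulr1 addrA lerDl.
apply: mulr_ge0; first exact: monom_ge0 (ltW u0) (ltW v0).
by apply: mulr_ge0; [case: (l0); exact: ltW|exact: wsum_ge0 (ltW u0) (ltW v0)].
Qed.

Lemma monom_small n (e : R) : 0 < e -> exists m0, forall m, (m0 <= m)%N ->
  monom (u n) (v n) (mkseq (W n) m) < e.
Proof.
move=> e0; have [m0 Hm] := exprn_small z0 z1 e0; exists m0 => m /Hm; apply: le_lt_trans.
have u0 := lu_gt0 d z0 n; have v0 := lv_gt0 d z0 n.
rewrite -{2}(size_mkseq (W n) m) -monom_size.
by rewrite /monom ler_pM ?exprn_ge0 ?lerXn2r ?nnegrE ?(ltW u0) ?(ltW v0) ?(ltW z0) ?lu_le ?lv_le.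
Qed.

(** The word starts with 1 and contains another 1, whose monomial [dl] exceeds the error made with a
    long enough prefix. *)
Lemma lh_gt1 n : 1 < h n.
Proof.
have u0 := lu_gt0 d z0 n; have v0 := lv_gt0 d z0 n.
have [Hg _] := dW; have [_ Hap _] := Hg n.
have [i [_ Wi]] := aperiodic_change false Hap; rewrite /= in Wi.
set dl := monom (u n) (v n) (mkseq (W n) i.+1).
have dl0 : 0 < dl by rewrite mulr_gt0 ?exprn_gt0.
have C10 : 0 <= C1 by exact: approx_const_ge0.
have C11 : 0 < C1 + 1 by move: C10; lra.
have [|m0 Hm0] := @monom_small n (dl * u n / (C1 + 1)).
  by apply: divr_gt0 => //; exact: mulr_gt0.
pose m := maxn m0 i.+2.
have := Hm0 m (leq_maxl _ _); have := level_approx (occ_mkseq (W n) m).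
have := @wsum_lower true n _ m Wi (leq_maxr _ _).
have := @wsum_lower true n 0 i.+1 (directive0 dW n) isT.
rewrite /= monom_nil add0r -/dl; set w := mkseq _ m; set mo := monom _ _ w.
move=> H1 H2; rewrite ler_norml => /andP[H3 _] H4.
have mo0 : 0 <= mo by rewrite monom_ge0 ?ltW.
have : C1 * (mo / u n) < dl.
  apply: (@le_lt_trans _ _ ((C1 + 1) * (mo / u n))).
    by rewrite ler_wpM2r ?lerDl // divr_ge0 // ltW.
  by rewrite mulrA ltr_pdivrMr // mulrC -ltr_pdivlMr //.
by move: H1 H2 H3; lra.
Qed.

(** In the limit of [wsum_telescope] this quantity is [1 - u n] times the sum over the zeros of
    [W n], and a 0 does occur. *)
Lemma lh_lt n : 0 < 1 - (1 - v n) * h n.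
Proof.
have u0 := lu_gt0 d z0 n; have v0 := lv_gt0 d z0 n.
have u1 : u n < 1 by apply: le_lt_trans (lu_le d z0 z1 n) z1.
have v1 : v n < 1 by apply: le_lt_trans (lv_le d z0 z1 n) z1.
have [Hg _] := dW; have [_ Hap _] := Hg n.
have [i [Wi _]] := aperiodic_change false Hap.
set dl := monom (u n) (v n) (mkseq (W n) i).
have dl0 : 0 < dl by rewrite mulr_gt0 ?exprn_gt0.
have C10 : 0 <= C1 by exact: approx_const_ge0.
have C11 : 0 < C1 + 1 by move: C10; lra.
have [|m0 Hm0] := @monom_small n ((1 - u n) * dl * u n / (C1 + 1)).
  by apply: divr_gt0 => //; apply: mulr_gt0 => //; apply: mulr_gt0 => //; rewrite subr_gt0.
pose m := maxn m0 i.+1.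
have := Hm0 m (leq_maxl _ _); have := level_approx (occ_mkseq (W n) m).
have := @wsum_lower false n _ m Wi (leq_maxr _ _).
have := wsum_telescope (u n) (v n) (mkseq (W n) m).
have := wsum_ge0 false (mkseq (W n) i) (ltW u0) (ltW v0).
rewrite -/dl; set w := mkseq _ m; set mo := monom _ _ w.
set HF := wsum false _ _ w; set HT := wsum true _ _ w => H0 tele H1 H2 H3.
have mo0 : 0 <= mo by rewrite monom_ge0 ?ltW.
have H4 : (1 - v n) * (h n - HT) < (1 - u n) * dl.
  apply: (@le_lt_trans _ _ ((C1 + 1) * (mo / u n))); last first.
    by rewrite mulrA ltr_pdivrMr // mulrC -ltr_pdivlMr //.
  apply: (@le_trans _ _ (C1 * (mo / u n))); last by rewrite ler_wpM2r ?lerDl // divr_ge0 // ltW.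
  apply: le_trans H2; apply: le_trans (ler_norm _) _; rewrite normrM ler_piMl //.
  by rewrite ger0_norm; lra.
have H5 : (1 - u n) * dl <= (1 - u n) * HF.
  by rewrite ler_pM2l ?subr_gt0 //; move: H0 H1; lra.
by rewrite mulrBr in H4; move: tele H4 H5 mo0; lra.
Qed.

(** Starting a run just after the opposite letter fixes which of the two lengths is the larger
    there. The given run is too long to begin at or before the position [m] of an opposite
    letter. *)
Lemma run_start r : (forall r, exists n c, forall i, (i < r)%N -> d (n + i)%N = c) ->
  exists n c, d n = ~~ c /\ forall i, (i < r)%N -> d (n.+1 + i)%N = c.
Proof.
move=> unb.
have [m1 _ dm1] := directive_recurrent dW false 0.
have [m2 _ dm2] := directive_recurrent dW true 0.
have [n [c Hc]] := unb (r + m1 + m2).+1.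
have [m Hm dm] : exists2 m, (m <= m1 + m2)%N & d m = ~~ c.
  by case: (c); [exists m1|exists m2]; rewrite ?leq_addr ?leq_addl.
have mn : (m < n)%N.
  rewrite ltnNge; apply/negP => nm; have E := Hc (m - n)%N; rewrite subnKC // dm in E.
  have : ~~ c = c by apply: E; lia.
  by case: (c).
have exP : exists k, (k < n)%N && (d k == ~~ c) by exists m; rewrite mn dm eqxx.
have ub k : (k < n)%N && (d k == ~~ c) -> (k <= n)%N by case/andP => /ltnW.
have [k /andP[kn /eqP dk] kmax] := ex_maxnP exP ub.
exists k, c; split=> // i Hi.
have [Hin|Hin] := ltnP (k.+1 + i)%N n; last first.
  by rewrite -(subnKC Hin); apply: Hc; lia.
apply/eqP/negPn/negP => H.
have H' : d (k.+1 + i)%N == ~~ c by move: H; case: (d _); case: (c).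
have := kmax (k.+1 + i)%N; rewrite Hin H' => /(_ isT); lia.
Qed.

Theorem unbounded_runs : (forall r, exists n c, forall i, (i < r)%N -> d (n + i)%N = c) -> False.
Proof.
move=> unb.
have [B [B1 key]] := @key_lower_bound R z X a b d z0 z1 ab alg XE.
pose o : 'I_2 := ord0; pose i : 'I_2 := ord_max.
pose ct (t : cube 2) : int := if t == (o, o, o) then 1 else if t == (o, o, i) then - 1
  else if t == (o, i, i) then 1 else 0.
pose cf (t : cube 2) : int := if t == (o, o, o) then - 1 else if t == (o, o, i) then 1 else 0.
have [At [At0 keyt]] := key 2 ct isT; have [Af [Af0 keyf]] := key 2 cf isT.
have cte n : peval ct (u n) (v n) (h n) = 1 - (1 - v n) * h n.
  by rewrite /peval big_cube2 /ct /= /o /i; ring.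
have cfe n : peval cf (u n) (v n) (h n) = h n - 1.
  by rewrite /peval big_cube2 /cf /= /o /i; ring.
have C10 : 0 <= C1 by exact: approx_const_ge0.
pose A := (1 + C1) * (At + Af + 1).
have A1 : 1 <= A.
  by rewrite /A -[leLHS]mulr1 ler_pM ?ler01 // ?lerDl // lerDr ltW // addr_gt0.
have B0 : 0 < B by exact: lt_le_trans ltr01 B1.
have A0 : 0 < A by exact: lt_le_trans ltr01 A1.
have AB0 : 0 < A * B ^+ 4 := mulr_gt0 A0 (exprn_gt0 4 B0).
(* Here [m = 2], and [lsum] is at most twice the larger length [L], so the loss is at most
   [B ^+ (4 * L)]; the gain from the run is [z ^+ (r * L)]. *)
have [|r Hr] := @exprn_small _ z (2^-1 / (A * B ^+ 4)) z0 z1.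
  by apply: divr_gt0 => //; rewrite invr_gt0.
have {}Hr : A * (z ^+ r * B ^+ 4) <= 2^-1.
  have := Hr r (leqnn r); rewrite ltr_pdivlMr // => /ltW H.
  by apply: le_trans H; rewrite le_eqVlt; apply/orP; left; apply/eqP; ring.
have fin (L : nat) : (0 < L)%N -> A * (z ^+ r * B ^+ 4) ^+ L < 1.
  move=> L0; have q0 : 0 <= z ^+ r * B ^+ 4 by rewrite mulr_ge0 ?exprn_ge0 ?ltW.
  have q1 : z ^+ r * B ^+ 4 <= 1.
    by have := ler_peMl q0 A1; move: Hr; lra.
  apply: le_lt_trans (_ : A * (z ^+ r * B ^+ 4) < 1); last by move: Hr; lra.
  by rewrite ler_pM2l // -[leRHS]expr1 ler_wiXn2l.
have arr (x1 x2 x3 x4 : R) : x1 * x2 * x3 * x4 = x1 * x3 * (x2 * x4) by ring.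
have [n0 [c [dn Hc]]] := @run_start r.+1 unb.
have run := directive_run dW Hc.
set n := n0.+1 in run Hc.
have u0 := lu_gt0 d z0 n; have v0 := lv_gt0 d z0 n.
have approx := level_approx run.
case: c dn Hc run approx => dn Hc run approx.
(* The word begins with [r.+2] ones, so [(1 - v) * h] differs from 1 by [O(v^r)]. The step before
   the run replaced 1 by 10, which makes the length of 1 the larger. *)
- have {}approx : `|h n - wsum true (u n) (v n) (nseq r.+2 true)| <=
    C1 * (monom (u n) (v n) (nseq r.+2 true) / u n) := approx.
  have lAB : (len d false n <= len d true n)%N by rewrite !lenS dn /= leq_addl.
  have vu : v n <= u n by rewrite /lu /lv ler_wiXn2l ?(ltW z0) ?(ltW z1).
  have P0 := lh_lt n.
  have tele := wsum_telescope (u n) (v n) (nseq r.+2 true).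
  have HF : wsum false (u n) (v n) (nseq r.+2 true) = 0.
    by elim: (r.+2) => //= k ->; rewrite mulr0 addr0.
  have mo : monom (u n) (v n) (nseq r.+2 true) = v n ^+ r.+2.
    by rewrite /monom !count_nseq /= mul0n mul1n mul1r.
  have v1 : v n < 1 by apply: le_lt_trans (lv_le d z0 z1 n) z1.
  have Ple : 1 - (1 - v n) * h n <= (1 + C1) * v n ^+ r.
    rewrite HF mulr0 add0r mo in tele; rewrite mo in approx.
    have H1 : v n ^+ r.+2 / u n <= v n ^+ r.
      have -> : v n ^+ r.+2 / u n = v n ^+ r * (v n * (v n / u n)) by rewrite !exprSr !mulrA.
      apply: ler_piMr; first exact/exprn_ge0/ltW.
      apply: mulr_ile1; [exact: ltW|exact/divr_ge0/ltW/u0/ltW|exact: ltW|].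
      by rewrite ler_pdivrMr // mul1r.
    have H2 : v n ^+ r.+2 <= v n ^+ r by rewrite ler_wiXn2l ?ltW // leqW.
    have H3 : C1 * (v n ^+ r.+2 / u n) <= C1 * v n ^+ r by rewrite ler_wpM2l.
    move: approx tele; set HT := wsum true _ _ _ => approx tele.
    have H4 : (1 - v n) * (HT - h n) <= `|h n - HT|.
      apply: le_trans (ler_norm _) _; rewrite normrM [in leRHS]distrC ler_piMl //.
      by rewrite ger0_norm; lra.
    by rewrite mulrBr tele in H4; move: approx H2 H3; lra.
  have := keyt n; rewrite cte => /(_ (lt0r_neq0 P0)).
  rewrite gtr0_norm //; apply/negP; rewrite -ltNge.
  apply: le_lt_trans (fin (len d true n) (len_gt0 _ _ _)).
  rewrite exprMn -!exprM -/(lv z d n).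
  apply: (@le_trans _ _ ((1 + C1) * v n ^+ r * (At + Af + 1) * B ^+ (4 * len d true n))).
    rewrite ler_pM ?mulr_ge0 ?exprn_ge0 ?(ltW P0) ?(ltW At0) ?(ltW B0) //.
      by rewrite ler_pM ?(ltW P0) ?(ltW At0) // -addrA lerDl addr_ge0 // ltW.
    by rewrite ler_weXn2l // /lsum; move: lAB; clear; lia.
  by rewrite [v n ^+ r]exprAC /lv -exprM arr.
(* The word begins with 1 and [r.+1] zeros, so [h - 1] is [O(u^r)]; here the length of 0 is the
   larger. *)
- have {}approx : `|h n - wsum true (u n) (v n) (true :: nseq r.+1 false)| <=
    C1 * (monom (u n) (v n) (true :: nseq r.+1 false) / u n) := approx.
  have lAB : (len d true n <= len d false n)%N by rewrite !lenS dn /= leq_addr.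
  have P0 : 0 < h n - 1 by rewrite subr_gt0; exact: lh_gt1.
  have HT : wsum true (u n) (v n) (true :: nseq r.+1 false) = 1.
    have E k : wsum true (u n) (v n) (nseq k false) = 0.
      by elim: k => //= k ->; rewrite mulr0 addr0.
    have E1 := E r.+1.
    transitivity (1 + v n * wsum true (u n) (v n) (nseq r.+1 false)); first by [].
    by rewrite E1 mulr0 addr0.
  have mo : monom (u n) (v n) (true :: nseq r.+1 false) = v n * u n ^+ r.+1.
    by rewrite monom_cons /monom !count_nseq /= mul0n mul1n mulr1.
  have v1 : v n < 1 by apply: le_lt_trans (lv_le d z0 z1 n) z1.
  have Ple : h n - 1 <= (1 + C1) * u n ^+ r.
    rewrite HT mo in approx.
    apply: le_trans (ler_norm _) _; apply: le_trans approx _.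
    rewrite exprSr mulrA mulfK ?gt_eqF //.
    apply: (@le_trans _ _ (C1 * u n ^+ r)).
      by rewrite ler_wpM2l // ler_piMl ?exprn_ge0 ?ltW.
    by apply: ler_wpM2r; [exact/exprn_ge0/ltW|rewrite lerDr].
  have := keyf n; rewrite cfe => /(_ (lt0r_neq0 P0)).
  rewrite gtr0_norm //; apply/negP; rewrite -ltNge.
  apply: le_lt_trans (fin (len d false n) (len_gt0 _ _ _)).
  rewrite exprMn -!exprM.
  apply: (@le_trans _ _ ((1 + C1) * u n ^+ r * (At + Af + 1) * B ^+ (4 * len d false n))).
    rewrite ler_pM ?mulr_ge0 ?exprn_ge0 ?(ltW P0) ?(ltW Af0) ?(ltW B0) //.
      by rewrite ler_pM ?(ltW P0) ?(ltW Af0) // addrAC lerDr addr_ge0 // ltW.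
    by rewrite ler_weXn2l // /lsum; move: lAB; clear; lia.
  by rewrite [u n ^+ r]exprAC /lu -exprM arr.
Qed.

End Runs.

(** * Bounded runs: lengths and slope *)

(** Compactness: a prefix occurring in [d] at arbitrarily large positions extends by some letter to
    another such prefix. *)
Lemma limit_word (d : nat -> bool) : exists d' : nat -> bool, forall K n0,
  exists2 n, (n0 <= n)%N & forall k, (k < K)%N -> d (n + k)%N = d' k.
Proof.
pose rec p := forall n0, exists2 n, (n0 <= n)%N &
  forall k, (k < size p)%N -> d (n + k)%N = nth false p k.
have step (p : {p | rec p}) : {q : {p | rec p} | exists l, sval q = rcons (sval p) l}.
  apply: cid; case: p => p Hp /=.
  suff [l Hl] : exists l, rec (rcons p l) by exists (exist _ _ Hl); exists l.
  apply/not_existsP => H.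
  have /existsNP[n1 H1] := H true; have /existsNP[n2 H2] := H false.
  have [n Hn E] := Hp (n1 + n2)%N.
  have ok : forall k, (k < size (rcons p (d (n + size p)%N)))%N ->
      d (n + k)%N = nth false (rcons p (d (n + size p)%N)) k.
    move=> k; rewrite size_rcons ltnS leq_eqVlt nth_rcons => /orP[/eqP->|kp].
      by rewrite ltnn eqxx.
    by rewrite kp E.
  case Ed: (d (n + size p)%N) ok => ok.
    by apply: H1; exists n => //; apply: leq_trans Hn; exact: leq_addr.
  by apply: H2; exists n => //; apply: leq_trans Hn; exact: leq_addl.
have rec0 : rec [::] by move=> n0; exists n0.
pose P n := iter n (fun p => sval (step p)) (exist _ _ rec0).
have PS n : exists l, sval (P n.+1) = rcons (sval (P n)) l by exact: svalP (step (P n)).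
have sP n : size (sval (P n)) = n.
  by elim: n => // n IH; have [l ->] := PS n; rewrite size_rcons IH.
exists (fun k => nth false (sval (P k.+1)) k) => K n0.
have Pnth k n : (k < n)%N -> nth false (sval (P n)) k = nth false (sval (P k.+1)) k.
  elim: n => // n IH; rewrite ltnS leq_eqVlt => /orP[/eqP->//|kn].
  by have [l ->] := PS n; rewrite nth_rcons sP kn IH.
have [n Hn E] := svalP (P K) n0; exists n => // k Hk.
by rewrite E ?sP // Pnth.
Qed.

Definition bounded_runs (d : nat -> bool) r := forall n c, exists2 i, (i < r)%N & d (n + i)%N = c.

Lemma limit_bounded_runs (d d' : nat -> bool) r : bounded_runs d r ->
  (forall K n0, exists2 n, (n0 <= n)%N & forall k, (k < K)%N -> d (n + k)%N = d' k) ->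
  bounded_runs d' r.
Proof.
move=> bd lim n c; have [m _ E] := lim (n + r)%N 0%N; have [i Hi Ei] := bd (m + n)%N c.
by exists i => //; rewrite -E ?ltn_add2l // addnA.
Qed.

Section Lengths.
Variables (d : nat -> bool) (r : nat).
Hypothesis bd : bounded_runs d r.

Lemma lsumS n : (lsum d n.+1 <= 2 * lsum d n)%N.
Proof. by rewrite /lsum !lenS; case: (d n) => /=; lia. Qed.

Lemma len_mono l n m : (n <= m)%N -> (len d l n <= len d l m)%N.
Proof.
move=> /subnKC <-; elim: (m - n)%N => [|k IH]; first by rewrite addn0.
by apply: leq_trans IH _; rewrite addnS lenS; case: eqP => // _; case: l; lia.
Qed.

Lemma lsum_growth n k : (lsum d (n + k) <= 2 ^ k * lsum d n)%N.
Proof.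
elim: k => [|k IH]; first by rewrite addn0 mul1n.
rewrite addnS expnS -mulnA; apply: leq_trans (lsumS _) _; by rewrite leq_mul2l IH orbT.
Qed.

(** One of the [r] steps before [n] replaces [l] by 10, so its length becomes the full sum. After
    that the sum at most doubles at each step. *)
Lemma len_ratio l n : (r <= n)%N -> (lsum d n <= 2 ^ r * len d l n)%N.
Proof.
move=> rn; have [i Hi Ei] := bd (n - r)%N (~~ l).
set m := (n - r + i)%N in Ei; have mn : (m < n)%N by rewrite /m; lia.
have E : len d l m.+1 = lsum d m by rewrite lenS Ei /lsum; case: (l) => /=; rewrite addnC.
have H1 := @lsum_growth m (n - m)%N; rewrite (subnKC (ltnW mn)) in H1.
apply: leq_trans H1 _; apply: leq_mul; first by rewrite leq_exp2l // /m; lia.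
by rewrite -E; exact: len_mono.
Qed.

Lemma lsum_large K : exists n0, forall n, (n0 <= n)%N -> (K <= lsum d n)%N.
Proof.
have S n : (n + 2 <= lsum d n)%N.
  elim: n => // n IH; rewrite /lsum !lenS; move: IH (len_gt0 d n true) (len_gt0 d n false).
  by rewrite /lsum; case: (d n) => /=; lia.
by exists K => n Hn; apply: leq_trans (S n); lia.
Qed.

(** If [i] and [j] do not have opposite signs, [len_ratio] suffices. Otherwise the form at level
    [n.+1] is the form [(i, i + j)] or [(i + j, j)] at level [n], which has no opposite signs or
    smaller coefficients: a subtractive Euclidean descent. *)
Lemma form_bound (i j : int) : (i != 0) || (j != 0) ->
  exists k n0, forall n, (n0 <= n)%N ->
    (lsum d n <= k * absz (i * (len d false n)%:Z + j * (len d true n)%:Z)%R)%N.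
Proof.
have base (i' j' : int) : (i' != 0) || (j' != 0) -> 0 <= i' * j' ->
  exists k n0, forall n, (n0 <= n)%N ->
    (lsum d n <= k * absz (i' * (len d false n)%:Z + j' * (len d true n)%:Z)%R)%N.
  move=> nz ij; exists (2 ^ r)%N, r => n rn.
  have HA := len_ratio false rn; have HB := len_ratio true rn.
  have [i0|i0] := boolP (i' != 0).
    apply: leq_trans HA _; rewrite leq_mul2l; apply/orP; right; move: i0 ij; clear; nia.
  apply: leq_trans HB _; rewrite leq_mul2l; apply/orP; right.
  move: nz ij; rewrite (negbTE i0) /= (eqP (negbNE i0)); clear; nia.
have [K] := ubnP (absz i + absz j)%N; elim: K i j => // K IH i j HK nz.
have [ij|ij] := boolP (0 <= i * j); first exact: base.
have half (i' j' : int) : (i' != 0) || (j' != 0) ->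
    (0 <= i' * j') || (absz i' + absz j' < absz i + absz j)%N ->
  exists k n0, forall n, (n0 <= n)%N ->
    (lsum d n <= k * absz (i' * (len d false n)%:Z + j' * (len d true n)%:Z)%R)%N.
  move=> nz' /orP[|lt]; first exact: base.
  by apply: IH => //; apply: leq_trans lt _; rewrite -ltnS.
have [||k1 [n1 H1]] := half i (i + j).
- by move: ij; clear; nia.
- by move: ij; clear; nia.
have [||k2 [n2 H2]] := half (i + j) j.
- by move: ij; clear; nia.
- by move: ij; clear; nia.
exists (2 * (k1 + k2))%N, (n1 + n2).+1 => -[//|n] Hn.
apply: leq_trans (lsumS n) _; rewrite -mulnA leq_mul2l /=.
have {}H1 := H1 n ltac:(lia); have {}H2 := H2 n ltac:(lia).
rewrite !lenS; case: (d n) => /=.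
  apply: leq_trans H1 _; apply: leq_mul; first exact: leq_addr.
  by rewrite PoszD mulrDr mulrDl; lia.
apply: leq_trans H2 _; apply: leq_mul; first exact: leq_addl.
by rewrite PoszD mulrDr mulrDl; lia.
Qed.

End Lengths.

(** * The slope of a directive sequence *)

Section Slope.
Variables (R : realType) (d : nat -> bool).
Hypothesis rec : forall c n, exists2 m, (n <= m)%N & d m = c.

Let cA l n := count negb (sig d n [:: l]).
Let cB l n := count id (sig d n [:: l]).

Lemma count_sig (P : pred bool) n w : count P (sig d n w) =
  (count id w * count P (sig d n [:: true]) + count negb w * count P (sig d n [:: false]))%N.
Proof.
rewrite [in LHS]sigE; elim: w => [|l w IH] //=.
by rewrite count_cat IH; case: l => /=; lia.
Qed.

Lemma count_det n : (cA false n * cB true n = cA true n * cB false n + 1)%N.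
Proof.
rewrite /cA /cB; elim: n => // n IH; rewrite !sigS1.
by case: (d n) => /=; rewrite !count_cat; lia.
Qed.

Lemma count_cross n m : (cA true n * cB false m <= cA false m * cB true n)%N.
Proof.
have D k : (cA true k * cB false k <= cA false k * cB true k)%N by rewrite count_det leq_addr.
rewrite /cA /cB in D *; have [nm|/ltnW mn] := leqP n m.
  rewrite -(subnKC nm) sig_add !(count_sig _ n (sig _ (m - n) _)) mulnDr mulnDl leq_add //.
    by rewrite mulnCA mulnA.
  by rewrite mulnCA -mulnA leq_mul2l D orbT.
rewrite -(subnKC mn) sig_add !(count_sig _ m (sig _ (n - m) _)) mulnDr mulnDl leq_add //.
  by rewrite [leqRHS]mulnCA -mulnA leq_mul2l D orbT.
by rewrite [leqRHS]mulnCA mulnA.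
Qed.

(** [theta] is the ratio of zeros to ones in the infinite word: the supremum of this ratio over the
    images of 1, bounded by the ratios in the images of 0 thanks to [count_cross]. *)
Lemma slope_exists : exists theta : R, 0 <= theta /\ forall n,
  0 <= theta * (cB true n)%:R - (cA true n)%:R /\ 0 <= (cA false n)%:R - theta * (cB false n)%:R.
Proof.
have bt n : (0 < cB true n)%N by have := count_det n; lia.
pose E : set R := [set x | exists n, x = (cA true n)%:R / (cB true n)%:R]%classic.
have ub m x : E x -> (0 < cB false m)%N -> x <= (cA false m)%:R / (cB false m)%:R.
  move=> [n ->] bf; rewrite ler_pdivrMr ?ltr0n // mulrAC ler_pdivlMr ?ltr0n //.
  by rewrite -!natrM ler_nat count_cross.
have [m _ dm] := rec true 0.
have bf : (0 < cB false m.+1)%N.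
  by rewrite /cB sigS1 dm /= count_cat addn_gt0; have := bt m; rewrite /cB => ->.
have supE : has_sup E.
  split; first by exists ((cA true 0)%:R / (cB true 0)%:R), 0%N.
  by exists ((cA false m.+1)%:R / (cB false m.+1)%:R) => x Ex; exact: ub.
have le n : (cA true n)%:R / (cB true n)%:R <= sup E.
  by apply: ub_le_sup; [case: supE|exists n].
exists (sup E); split; first by have := le 0%N; rewrite /cA /= mul0r.
move=> n; split; rewrite subr_ge0; first by rewrite -ler_pdivrMr ?ltr0n.
have [/eqP E0|] := boolP (cB false n == 0)%N; first by rewrite E0 mulr0 ler0n.
rewrite -lt0n => b0; rewrite -ler_pdivlMr ?ltr0n //.
by apply: ge_sup; [case: supE|move=> x Ex; exact: ub].
Qed.

Lemma count_pref_large K : exists k0, forall k, (k0 <= k)%N -> (K <= count id (pref d k))%N.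
Proof.
have monoB l n m : (n <= m)%N -> (cB l n <= cB l m)%N.
  move=> /subnKC <-; elim: (m - n)%N => [|k IH]; first by rewrite addn0.
  apply: leq_trans IH _; rewrite addnS /cB sigS1; case: eqP => // _.
  by rewrite count_cat; case: l; [exact: leq_addr|exact: leq_addl].
elim: K => [|K [k0 IH]]; first by exists 0%N.
have [m1 H1 d1] := rec true k0; have [m2 H2 d2] := rec false m1.+1.
exists m2.+1 => k Hk; apply: leq_trans (monoB true _ _ Hk).
rewrite /cB sigS1 d2 /= count_cat -addn1 leq_add ?IH //; first by lia.
apply: leq_trans (monoB false _ _ H2); rewrite /cB sigS1 d1 /= count_cat addn_gt0.
by have := count_det m1; rewrite /cB; lia.
Qed.

Variable theta : R.
Hypothesis theta0 : 0 <= theta.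
Hypothesis theta_slope : forall n,
  0 <= theta * (cB true n)%:R - (cA true n)%:R /\ 0 <= (cA false n)%:R - theta * (cB false n)%:R.

Let xi n := theta * (cB true n)%:R - (cA true n)%:R.
Let eta n := (cA false n)%:R - theta * (cB false n)%:R.

(** Together with [etaS], this is the subtractive Euclidean algorithm started at [(theta, 1)] and
    driven by [d]. *)
Lemma xiS n : xi n.+1 = if d n then xi n else xi n - eta n.
Proof. by rewrite /xi /eta /cA /cB sigS1; case: (d n) => //=; rewrite !count_cat !natrD; ring. Qed.

Lemma etaS n : eta n.+1 = if d n then eta n - xi n else eta n.
Proof. by rewrite /xi /eta /cA /cB sigS1; case: (d n) => //=; rewrite !count_cat !natrD; ring. Qed.

Lemma xi_ge0 n : 0 <= xi n. Proof. by have [] := theta_slope n. Qed.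
Lemma eta_ge0 n : 0 <= eta n. Proof. by have [] := theta_slope n. Qed.

Lemma xi_eta_neq0 n : xi n = 0 -> eta n = 0 -> False.
Proof.
rewrite /xi /eta => /eqP; rewrite subr_eq0 => /eqP E1 /eqP; rewrite subr_eq0 => /eqP E2.
have E : (cA false n)%:R * (cB true n)%:R = (cA true n)%:R * (cB false n)%:R + 1 :> R.
  by rewrite -!natrM natr1 count_det addn1.
suff /eqP : (1 : R) = 0 by rewrite oner_eq0.
rewrite -E1 E2 in E.
by apply: (@addrI _ (theta * (cB true n)%:R * (cB false n)%:R)); rewrite -E; ring.
Qed.

(** If [xi] vanished it would stay 0 until the next false letter of [d], where its new value [- eta]
    forces [eta] to vanish too, against [count_det]. *)
Lemma xi_gt0 n : 0 < xi n.
Proof.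
rewrite lt_neqAle xi_ge0 andbT eq_sym; apply/eqP => E.
have [m] := rec false n; elim: (m - n)%N {-2}n (erefl (m - n)%N) E => [|k IH] n' Ek E nm dm.
  have mn : n' = m by lia.
  rewrite mn in E; have := xi_ge0 m.+1; rewrite xiS dm E sub0r oppr_ge0 => H.
  by apply: (xi_eta_neq0 E); apply/eqP; rewrite eq_le H eta_ge0.
case Ed: (d n').
  by apply: (IH n'.+1) => //; [lia|rewrite xiS Ed|lia].
have := xi_ge0 n'.+1; rewrite xiS Ed E sub0r oppr_ge0 => H.
by apply: (xi_eta_neq0 E); apply/eqP; rewrite eq_le H eta_ge0.
Qed.

Lemma eta_gt0 n : 0 < eta n.
Proof.
rewrite lt_neqAle eta_ge0 andbT eq_sym; apply/eqP => E.
have [m] := rec true n; elim: (m - n)%N {-2}n (erefl (m - n)%N) E => [|k IH] n' Ek E nm dm.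
  have mn : m = n' by lia.
  by have := xi_gt0 n'; have := eta_ge0 n'.+1; rewrite etaS -mn dm mn E; lra.
case Ed: (d n').
  by have := xi_gt0 n'; have := eta_ge0 n'.+1; rewrite etaS Ed E; lra.
by apply: (IH n'.+1) => //; [lia|rewrite etaS Ed|lia].
Qed.

(** The form is [i * xi 0 + j * eta 0]. The descent is that of [form_bound], now towards higher
    levels, and positivity of [xi] and [eta] settles the case without opposite signs. *)
Lemma slope_irrational (i j : int) : (i != 0) || (j != 0) -> i%:~R * theta + j%:~R != 0.
Proof.
have base n (i' j' : int) : (i' != 0) || (j' != 0) -> 0 <= i' * j' ->
    i'%:~R * xi n + j'%:~R * eta n != 0.
  move=> nz ij; have x0 := xi_gt0 n; have e0 := eta_gt0 n.
  wlog : i' j' nz ij / 0 <= i' /\ 0 <= j' => [W|[i0 j0]].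
    have [i0|i0] := leP 0 i'; have [j0|j0] := leP 0 j'.
    - exact: W.
    - have ie : i' = 0 by move: i0 j0 ij; clear; nia.
      by rewrite ie mul0r add0r; apply: mulf_neq0; [rewrite intr_eq0 lt_eqF|rewrite gt_eqF].
    - have je : j' = 0 by move: i0 j0 ij; clear; nia.
      by rewrite je mul0r addr0; apply: mulf_neq0; [rewrite intr_eq0 lt_eqF|rewrite gt_eqF].
    - have := W (- i') (- j'); rewrite !oppr_eq0 mulrNN => /(_ nz ij).
      rewrite !oppr_ge0 !ltW // !rmorphN /= !mulNr -opprD oppr_eq0; exact.
  rewrite gt_eqF //; case/orP: nz => nz.
    rewrite ltr_pwDl ?mulr_gt0 ?mulr_ge0 ?(ltW e0) ?ler0z ?ltr0z //; lia.
  rewrite ltr_pwDr ?mulr_gt0 ?mulr_ge0 ?(ltW x0) ?ler0z ?ltr0z //; lia.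
suff main n (i' j' : int) : (i' != 0) || (j' != 0) -> i'%:~R * xi n + j'%:~R * eta n != 0.
  by move=> /(main 0%N); rewrite /xi /eta /cA /cB /= mulr0 !subr0 !mulr1.
have [K] := ubnP (absz i' + absz j')%N; elim: K n i' j' => // K IH n {i j}i j HK nz.
have [ij|ij] := boolP (0 <= i * j); first exact: base.
have half (i' j' : int) : (i' != 0) || (j' != 0) ->
    (0 <= i' * j') || (absz i' + absz j' < absz i + absz j)%N ->
  i'%:~R * xi n.+1 + j'%:~R * eta n.+1 != 0.
  move=> nz' /orP[|lt]; first exact: base.
  by apply: IH => //; apply: leq_trans lt _; rewrite -ltnS.
case Ed: (d n).
  have : (i + j)%:~R * xi n.+1 + j%:~R * eta n.+1 != 0 by apply: half; move: ij; clear; nia.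
  rewrite xiS etaS Ed intrD; apply: contraNN => /eqP E; apply/eqP; rewrite -[RHS]E; ring.
have : i%:~R * xi n.+1 + (i + j)%:~R * eta n.+1 != 0 by apply: half; move: ij; clear; nia.
rewrite xiS etaS Ed intrD; apply: contraNN => /eqP E; apply/eqP; rewrite -[RHS]E; ring.
Qed.

(** A discrepancy whose weights are adapted to the level, so that applying [tau (d n)] carries it
    from level [n.+1] to level [n] unchanged. *)
Let val n p := xi n * (count id p)%:R - eta n * (count negb p)%:R.

Lemma val_sub n q : val n (sub (d n) q) = val n.+1 q.
Proof.
rewrite /val xiS etaS; elim: q => [|l q IH]; first by rewrite /= !mulr0.
have -> : sub (d n) (l :: q) = tau (d n) l ++ sub (d n) q by [].
rewrite !count_cat /= !natrD; move: IH.
by case: (d n); case: l => /= IH; rewrite ?addn0 ?add0n ?natrD; move: IH; lra.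
Qed.

(** A cut of an image lies at a block boundary, where the next letter is [l' || c], or inside a
    block 10. *)
Lemma sub_split c s p l r : sub c s = p ++ l :: r -> exists q l' r',
  s = q ++ l' :: r' /\ ((p = sub c q /\ l = (l' || c)) \/ (p = sub c q ++ [:: true] /\ l = false /\ l' != c)).
Proof.
elim: s p => [|l0 s IH] p; first by case: p.
have -> : sub c (l0 :: s) = tau c l0 ++ sub c s by [].
rewrite /tau; have [E|ne] := eqVneq l0 c.
  case: p => [|l1 p] /= [<-].
    by move=> _; exists [::], l0, s; split=> //; left; rewrite E orbb.
  move=> /IH[q [l' [r' [-> H]]]]; exists (l0 :: q), l', r'; split=> //.
  have -> : sub c (l0 :: q) = c :: sub c q by rewrite /sub /= /tau E eqxx.
  by case: H => -[-> H]; [left|right].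
case: p => [|l1 [|l2 p]] /= [<-].
- move=> _; exists [::], l0, s; split=> //; left; split=> //.
  by case: l0 ne; case: (c).
- by case=> <- _; exists [::], l0, s; split=> //; right.
case=> <- /IH[q [l' [r' [-> H]]]]; exists (l0 :: q), l', r'; split=> //.
have -> : sub c (l0 :: q) = true :: false :: sub c q by rewrite /sub /= /tau (negbTE ne).
by case: H => -[-> H]; [left|right].
Qed.

(** By [val_sub] a cut at a block boundary keeps its value from level [n.+1], and a cut inside a
    block adds [xi n]. The bound must depend on the next letter for the induction to close. *)
Lemma discrepancy k n p l r : pref (fun i => d (n + i)%N) k = p ++ l :: r ->
  0 <= val n p <= (if l then eta n else xi n + eta n).
Proof.
elim: k n p l r => [|k IH] n p l r.
  case: p => [|? []] //= [<- _]; rewrite /val /= !mulr0 subrr lexx /=; exact: ltW (eta_gt0 n).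
rewrite /pref sig_outer addn0 => /sub_split[q [l' [r' [E H]]]].
have {}IH : 0 <= val n.+1 q <= (if l' then eta n.+1 else xi n.+1 + eta n.+1).
  apply: (IH n.+1 q l' r'); rewrite -E /pref; apply: eq_sig => i _; by rewrite addSnnS.
have x0 := xi_gt0 n; have e0 := eta_gt0 n.
rewrite -val_sub xiS etaS in IH; case: H => -[-> ].
  by move=> ->; case: (d n) IH; case: l' {E} => /= /andP[H1 H2]; apply/andP; split; lra.
move=> [-> ne].
have -> : val n (sub (d n) q ++ [:: true]) = val n (sub (d n) q) + xi n.
  by rewrite /val !count_cat /= addn0 natrD; ring.
by case: (d n) IH ne; case: l' {E} => //= /andP[H1 H2] _; apply/andP; split; lra.
Qed.

(** On the curve [v = u^(-theta)] with [u >= 1], the monomials of these prefixes therefore stay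
    between [u^(-1)] and 1. *)
Lemma pref_discrepancy k p r : pref d k = p ++ true :: r ->
  0 <= theta * (count id p)%:R - (count negb p)%:R <= 1.
Proof.
move=> /(@discrepancy k 0); rewrite /val /xi /eta /cA /cB /= !mulr0 !subr0 mulr1 mul1r.
by [].
Qed.

End Slope.

(** * Transcendence of the limit series *)

Lemma eventually_fin (I : finType) (P : I -> nat -> Prop) :
  (forall i, exists n0, forall n, (n0 <= n)%N -> P i n) ->
  exists n0, forall n, (n0 <= n)%N -> forall i, P i n.
Proof.
move=> /choice[f Hf]; exists (\max_i f i)%N => n Hn i; apply: Hf.
by apply: leq_trans Hn; exact: leq_bigmax.
Qed.

(** All other terms together are at most half the largest monomial, whose nonzero integer
    coefficient is at least 1 in absolute value. *)
Lemma dominant (R : realType) (I : finType) (c : I -> int) (m : I -> R) (e : R) (i1 : I) :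
  (forall i, 0 < m i) -> c i1 != 0 -> 0 <= e -> e * \sum_i `|(c i)%:~R| <= 2^-1 ->
  (forall i j, i != j -> c i != 0 -> c j != 0 -> m i <= e * m j \/ m j <= e * m i) ->
  exists i0, [/\ c i0 != 0, forall j, c j != 0 -> m j <= m i0 &
    m i0 / 2 <= `|\sum_i (c i)%:~R * m i|].
Proof.
move=> m0 ci1 e0 eS sep.
have [i0 ci0 imax] := @arg_maxP _ _ _ i1 (fun i => c i != 0) m ci1.
have {}imax j : c j != 0 -> m j <= m i0 by exact: imax.
exists i0; split=> //.
rewrite (bigD1 i0) //=; set rest := \sum_(_ | _) _.
have Hrest : `|rest| <= m i0 / 2.
  apply: (@le_trans _ _ (\sum_(i | i != i0) `|(c i)%:~R| * (e * m i0))).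
    apply: le_trans (ler_norm_sum _ _ _) _; apply: ler_sum => j ji.
    rewrite normrM (gtr0_norm (m0 j)).
    have [->|cj] := eqVneq (c j) 0; first by rewrite normr0 !mul0r.
    rewrite ler_wpM2l //; case: (sep j i0 ji cj ci0) => // H.
    apply: le_trans (imax _ cj) _; apply: le_trans H _.
    by rewrite ler_wpM2l // imax.
  rewrite -mulr_suml mulrA [leRHS]mulrC ler_pM2r // mulrC.
  apply: le_trans eS; rewrite ler_wpM2l //.
  by rewrite [leRHS](bigD1 i0) //= lerDr.
have c1 : 1 <= `|(c i0)%:~R| :> R by rewrite -intr_norm -abszE -pmulrn ler1n absz_gt0.
apply: le_trans (lerB_normD _ _); rewrite normrM (gtr0_norm (m0 i0)).
have : m i0 <= `|(c i0)%:~R| * m i0 by rewrite ler_peMl // ltW.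
by move: Hrest; lra.
Qed.

Lemma rmorph_peval (S S' : comNzRingType) (f : {rmorphism S -> S'}) m (c : cube m -> int) u v h :
  f (peval c u v h) = peval c (f u) (f v) (f h).
Proof.
rewrite /peval rmorph_sum; apply: eq_bigr => t _.
by rewrite !rmorphM rmorph_int !rmorphXn.
Qed.

Definition pcoef (S : comNzRingType) m (c : cube m -> int) (u v : S) (l : 'I_m) : S :=
  \sum_(p : 'I_m * 'I_m) (c (p, l))%:~R * (u ^+ p.1 * v ^+ p.2).

Lemma pevalE (S : comNzRingType) m (c : cube m -> int) (u v h : S) :
  peval c u v h = \sum_(l < m) pcoef c u v l * h ^+ l.
Proof.
rewrite /peval (eq_bigr (fun t : cube m => (c (t.1, t.2))%:~R * (u ^+ t.1.1 * v ^+ t.1.2 * h ^+ t.2))) => [|[] //].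
rewrite -(pair_bigA _ (fun p l => (c (p, l))%:~R * (u ^+ p.1 * v ^+ p.2 * h ^+ l))) /=.
rewrite exchange_big /=; apply: eq_bigr => l _; rewrite /pcoef mulr_suml.
by apply: eq_bigr => p _; rewrite !mulrA.
Qed.

Section Dominated.
Variable R : realType.

Definition dom (p q : {poly R}) := forall j, `|p`_j| <= q`_j.

Lemma dom0 : dom 0 0. Proof. by move=> j; rewrite coef0 normr0. Qed.

Lemma domD p q p' q' : dom p q -> dom p' q' -> dom (p + p') (q + q').
Proof. by move=> H H' j; rewrite !coefD; apply: le_trans (ler_normD _ _) _; exact: lerD. Qed.

Lemma domM p q p' q' : dom p q -> dom p' q' -> dom (p * p') (q * q').
Proof.
move=> H H' j; rewrite !coefM; apply: le_trans (ler_norm_sum _ _ _) _.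
by apply: ler_sum => i _; rewrite normrM ler_pM.
Qed.

Lemma domC (a b : R) : `|a| <= b -> dom a%:P b%:P.
Proof. by move=> ab j; rewrite !coefC; case: eqP; rewrite // normr0. Qed.

Lemma domXX : dom 'X 'X.
Proof. by move=> j; rewrite !coefX; case: eqP; rewrite ?normr1 ?normr0. Qed.

Lemma domX p q n : dom p q -> dom (p ^+ n) (q ^+ n).
Proof.
move=> H; elim: n => [|n IH]; last by rewrite !exprS; exact: domM.
by rewrite !expr0; apply: domC; rewrite normr1.
Qed.

Lemma dom_wsum (u : R) w : 0 <= u -> dom (wsum true u%:P 'X w) (wsum true u%:P 'X w).
Proof.
move=> u0; elim: w => [|l w IH] /=; first exact: dom0.
apply: domD; first by case: l; [apply: domC; rewrite normr1|exact: dom0].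
apply: domM => //; case: l; first exact: domXX.
by apply: domC; rewrite ger0_norm.
Qed.

Lemma dom_peval m (c : cube m -> int) (u : R) w : 0 <= u ->
  dom (peval c u%:P 'X (wsum true u%:P 'X w))
      (peval (fun t => `|c t|) u%:P 'X (wsum true u%:P 'X w)).
Proof.
move=> u0; rewrite /peval; apply: (big_ind2 dom) => [||t _]; [exact: dom0|exact: domD|].
apply: domM.
  have E (n : int) : n%:~R = (n%:~R)%:P :> {poly R} by rewrite rmorph_int.
  by rewrite !E; apply: domC; rewrite intr_norm.
apply: domM; last exact/domX/dom_wsum.
apply: domM; apply: domX; last exact: domXX.
by apply: domC; rewrite ger0_norm.
Qed.

(** Vanishing of the coefficients below [t] gains the factor [r ^+ t] when the argument shrinks by
    [r]. *)
Lemma dom_tail (p q : {poly R}) (x r : R) t : dom p q -> (forall j, (j < t)%N -> p`_j = 0) ->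
  0 <= x -> 0 <= r <= 1 -> `|p.[r * x]| <= r ^+ t * q.[x].
Proof.
move=> pq p0 x0 /andP[r0 r1]; set n := maxn (size p) (size q).
rewrite (@horner_coef_wide _ n) ?leq_maxl // (@horner_coef_wide _ n q) ?leq_maxr //.
apply: le_trans (ler_norm_sum _ _ _) _; rewrite mulr_sumr; apply: ler_sum => j _.
have [jt|tj] := ltnP j t.
  rewrite p0 // mul0r normr0 mulr_ge0 ?exprn_ge0 // mulr_ge0 ?exprn_ge0 //.
  exact: le_trans (pq j).
rewrite normrM [r ^+ t * _]mulrCA ler_pM // normrX normrM !ger0_norm // exprMn.
by rewrite ler_wpM2r ?exprn_ge0 // ler_wiXn2l.
Qed.

Lemma wsum_compare (u v q k : R) w : 0 <= k ->
  (forall p r, w = p ++ true :: r -> k * monom 1 q p <= monom u v p <= monom 1 q p) ->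
  k * wsum true 1 q w <= wsum true u v w <= wsum true 1 q w.
Proof.
move=> k0; elim/last_ind: w => [|w l IH] H; first by rewrite /= mulr0 lexx.
have /andP[H1 H2] : k * wsum true 1 q w <= wsum true u v w <= wsum true 1 q w.
  by apply: IH => p r E; apply: (H p (rcons r l)); rewrite E rcons_cat.
rewrite -cats1 !wsum_cat /= !mulr0 !addr0; case: l H => H /=; last by rewrite !mulr0 !addr0 H1.
have /andP[H3 H4] := H w [::] (esym (cats1 _ _)).
by rewrite !mulr1 mulrDr !lerD.
Qed.

End Dominated.

(** The inner variable stands for [u] and the outer one for [v]. *)
Definition bipoly m (c : cube m -> int) w : {poly {poly int}} :=
  peval c ('X)%:P 'X (wsum true ('X)%:P 'X w).

Section Transcendence.
Variables (R : realType) (d : nat -> bool) (theta : R).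
Hypothesis rec : forall c n, exists2 m, (n <= m)%N & d m = c.
Hypothesis disc : forall k p r, pref d k = p ++ true :: r ->
  0 <= theta * (count id p)%:R - (count negb p)%:R <= 1.
Hypothesis irr : forall i j : int, (i != 0) || (j != 0) -> i%:~R * theta + j%:~R != 0.

(** Irrationality of [theta] makes the exponents [lam p] distinct, so one exponential dominates for
    large [s]. *)
Lemma exp_poly_neq0 m (c : 'I_m * 'I_m -> int) p1 : c p1 != 0 ->
  exists s : nat, \sum_p (c p)%:~R * (expR s%:R ^+ p.1 * expR (- (theta * s%:R)) ^+ p.2) != 0 :> R.
Proof.
move=> cp1; pose lam (p : 'I_m * 'I_m) : R := p.1%:R - theta * p.2%:R.
have monE s (p : 'I_m * 'I_m) : expR s%:R ^+ p.1 * expR (- (theta * s%:R)) ^+ p.2 = expR (lam p) ^+ s.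
  rewrite -!expRM_natl -expRD; congr expR; rewrite /lam; ring.
have lam_inj p p' : p != p' -> lam p != lam p'.
  apply: contraNneq => E.
  have [nz|] := boolP ((p'.2%:Z - p.2%:Z != 0) || (p.1%:Z - p'.1%:Z != 0)).
    have := irr nz; rewrite !intrD !mulrNz -!pmulrn => /eqP; case.
    by move: E; rewrite /lam; lra.
  rewrite negb_or !negbK !subr_eq0 => /andP[/eqP[E2] /eqP[E1]].
  by case: p p' E1 E2 {E} => [a b] [a' b'] /= /val_inj-> /val_inj->.
pose S : R := \sum_p `|(c p)%:~R|; have S0 : 0 <= S by exact: sumr_ge0.
pose e : R := 2^-1 / (S + 1); have e0 : 0 < e by rewrite divr_gt0 ?invr_gt0 ?ltr_wpDl.
have [s0 Hs] : exists s0, forall s, (s0 <= s)%N -> forall pp : ('I_m * 'I_m) * ('I_m * 'I_m),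
    pp.1 != pp.2 -> expR (lam pp.1) ^+ s <= e * expR (lam pp.2) ^+ s \/
                    expR (lam pp.2) ^+ s <= e * expR (lam pp.1) ^+ s.
  apply: eventually_fin => -[p p'] /=.
  have [<-|ne] := eqVneq p p'; first by exists 0%N.
  have key q q' : lam q < lam q' -> exists n0, forall n, (n0 <= n)%N ->
      expR (lam q) ^+ n <= e * expR (lam q') ^+ n.
    move=> lt; have [|||n0 Hn0] := @exprn_small R (expR (lam q - lam q')) e.
    - exact: expR_gt0.
    - by rewrite expR_lt1 subr_lt0.
    - exact: e0.
    exists n0 => n /Hn0/ltW H.
    have -> : expR (lam q) ^+ n = expR (lam q - lam q') ^+ n * expR (lam q') ^+ n.
      by rewrite -exprMn -expRD subrK.
    by rewrite ler_wpM2r ?exprn_ge0 ?expR_ge0.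
  have := lam_inj _ _ ne; rewrite neq_lt => /orP[] /key[n0 Hn0]; exists n0 => n /Hn0 H _.
    by left.
  by right.
exists s0.
have [|||||i0 [_ _ H]] := @dominant R _ c (fun p => expR (lam p) ^+ s0) e p1.
- by move=> p; rewrite exprn_gt0 ?expR_gt0.
- exact: cp1.
- exact: ltW.
- rewrite -/S /e mulrAC ler_pdivrMr ?ltr_wpDl // ler_wpM2l ?invr_ge0 // lerDl //.
- by move=> i j ij _ _; exact: (Hs s0 (leqnn _) (i, j)).
rewrite -normr_gt0; under eq_bigr => p _ do rewrite monE.
by apply: lt_le_trans H; rewrite divr_gt0 ?exprn_gt0 ?expR_gt0.
Qed.

Lemma monom_exp (s q : R) p : monom (expR s) (q * expR (- (theta * s))) p =
  expR (- (s * (theta * (count id p)%:R - (count negb p)%:R))) * monom 1 q p.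
Proof.
rewrite /monom expr1n mul1r exprMn -!expRM_natl mulrCA -expRD mulrC; congr (expR _ * _); ring.
Qed.

(** By [disc] each term lies between [e^(-s)] times a power of [q] and that power. The sum is thus
    comparable with a geometric one, which becomes large as [q] tends to 1. *)
Lemma wsum_exp (s q : R) k : 0 <= s -> 0 <= q ->
  expR (- s) * wsum true 1 q (pref d k) <= wsum true (expR s) (q * expR (- (theta * s))) (pref d k)
  <= wsum true 1 q (pref d k).
Proof.
move=> s0 q0; apply: wsum_compare; first exact: expR_ge0.
move=> p r /disc/andP[H0 H1]; rewrite monom_exp.
have mo0 : 0 <= monom 1 q p by apply: monom_ge0.
rewrite ler_wpM2r //=; last by rewrite ler_expR lerN2 ler_piMr.
by rewrite ler_piMl // expR_le1 oppr_le0 mulr_ge0.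
Qed.

Lemma wsum1 (q : R) w : (1 - q) * wsum true 1 q w = 1 - q ^+ count id w.
Proof.
have := wsum_telescope 1 q w; rewrite subrr mul0r add0r => ->.
by rewrite /monom expr1n mul1r.
Qed.

(** If all the stable coefficients vanished, the values at [(u, q * V)] would tend to 0 along the
    prefixes. For [q] close to 1, however, the sum [h] is so large that its leading power keeps them
    above [al / 2]. *)
Theorem bipoly_neq0 m (c : cube m -> int) t1 : c t1 != 0 ->
  exists k j i, (j < count id (pref d k))%N /\ (bipoly c (pref d k))`_j`_i != 0.
Proof.
move=> ct1; apply: contrapT => H.
have coef0 k j : (j < count id (pref d k))%N -> (bipoly c (pref d k))`_j = 0.
  move=> Hj; apply/polyP => i; rewrite coef0; apply/eqP/negPn/negP => ne.
  by apply: H; exists k, j, i.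
have [r /existsP[p1 cp1] rmax] := @arg_maxnP _ t1.2 (fun l => [exists p, c (p, l) != 0]) (@nat_of_ord m)
   ltac:(by apply/existsP; exists t1.1; rewrite -surjective_pairing).
have {}rmax l p : c (p, l) != 0 -> (l <= r)%N.
  by move=> cp; apply: rmax; apply/existsP; exists p.
have [s a0] := exp_poly_neq0 (c := fun p => c (p, r)) cp1.
set u := expR s%:R in a0; set V := expR (- (theta * s%:R)) in a0.
rewrite -/(pcoef c u V r) in a0.
have u0 : 0 < u by exact: expR_gt0.
have V0 : 0 < V by exact: expR_gt0.
pose La l := \sum_(p : 'I_m * 'I_m) `|(c (p, l))%:~R| * (u ^+ p.1 * V ^+ p.2).
have La0 l : 0 <= La l by apply: sumr_ge0 => p _; rewrite !mulr_ge0 ?exprn_ge0 ?(ltW u0) ?(ltW V0).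
pose L := \sum_l La l.
have L0 : 0 <= L by apply: sumr_ge0.
have LaL l : La l <= L by rewrite /L (bigD1 l) //= lerDl sumr_ge0.
pose al := `|pcoef c u V r|; have al0 : 0 < al by rewrite normr_gt0.
pose ka := expR (- s%:R) : R; have ka0 : 0 < ka by exact: expR_gt0.
have ka1 : ka <= 1 by rewrite expR_le1 oppr_le0.
(* [al / D] is small enough for every upper bound on [1 - q] required below. *)
pose D := 4 * m%:R * L + 8 * L / ka + 2 * al / ka + 1 + al.
have D1 : 0 <= 4 * m%:R * L by rewrite !mulr_ge0.
have D2 : 0 <= 8 * L / ka by rewrite divr_ge0 ?mulr_ge0 ?(ltW ka0).
have D3 : 0 <= 2 * al / ka by rewrite divr_ge0 ?(ltW ka0) // mulr_ge0 ?(ltW al0).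
have D0 : 0 < D by rewrite /D; move: D1 D2 D3 al0; lra.
pose ep := al / D.
have ep0 : 0 < ep by rewrite divr_gt0.
have ep1 : ep < 1 by rewrite ltr_pdivrMr // mul1r /D; move: D1 D2 D3; lra.
have epD : D * ep = al by rewrite mulrC divfK // gt_eqF.
have [q1 q1E] : exists q1, q1 = 1 - ep / 2 by exists (1 - ep / 2).
(* Passing from [q1 * V], where the majorant is still bounded, to [q * V] shrinks the argument by
   [q1]; this is the factor used in [small]. *)
have [q qE] : exists q, q = q1 * q1 by exists (q1 * q1).
have q10 : 0 < q1 by rewrite q1E; move: ep0 ep1; lra.
have q11 : q1 < 1 by rewrite q1E; move: ep0 ep1; lra.
have q0 : 0 < q by rewrite qE mulr_gt0.
have q1' : q < 1 by rewrite qE mulr_ilt1 // ltW.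
have qep : 1 - q <= ep.
  have : 0 <= ep * ep by rewrite mulr_ge0 ?(ltW ep0).
  by rewrite qE q1E; lra.
pose MF := peval (fun t => `|c t|) u (q1 * V) (1 - q1)^-1.
have MF0 : 0 <= MF.
  rewrite /MF /peval sumr_ge0 // => t _.
  by rewrite mulr_ge0 ?ler0z // !mulr_ge0 ?exprn_ge0 ?mulr_ge0 ?invr_ge0 ?subr_ge0 ?(ltW u0) ?(ltW V0) ?(ltW q10) ?(ltW q11).
have small k : `|peval c u (q * V) (wsum true u (q * V) (pref d k))| <= q1 ^+ count id (pref d k) * MF.
  set w := pref d k.
  pose E1 : {poly R} := peval c u%:P 'X (wsum true u%:P 'X w).
  pose F1 : {poly R} := peval (fun t => `|c t|) u%:P 'X (wsum true u%:P 'X w).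
  have ev c' v' : (peval c' u%:P 'X (wsum true u%:P 'X w) : {poly R}).[v'] =
      peval c' u v' (wsum true u v' w).
    rewrite -[LHS]/(horner_eval v' _) rmorph_peval rmorph_wsum /=.
    by rewrite /horner_eval hornerC hornerX.
  have E1E : E1 = map_poly (ieval u) (bipoly c w).
    rewrite /bipoly rmorph_peval rmorph_wsum /= map_polyC map_polyX /=.
    by rewrite /ieval map_polyX hornerX.
  have := @dom_tail R E1 F1 (q1 * V) q1 (count id w) (dom_peval c w (ltW u0)).
  rewrite !ev mulrA -qE; move=> /(_ _ _ _)HH; apply: le_trans (HH _ _ _) _.
  - by move=> j Hj; rewrite E1E coef_map /= coef0 //; exact: rmorph0.
  - by rewrite mulr_ge0 ?ltW.
  - by rewrite !ltW.
  rewrite ler_wpM2l ?exprn_ge0 ?(ltW q10) // /MF /peval; apply: ler_sum => t _.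
  rewrite ler_wpM2l ?ler0z // ler_wpM2l ?mulr_ge0 ?exprn_ge0 ?mulr_ge0 ?(ltW u0) ?(ltW V0) ?(ltW q10) //.
  have /andP[_ Hw] := wsum_exp k (ler0n R s) (ltW q10).
  rewrite lerXn2r ?nnegrE ?wsum_ge0 ?invr_ge0 ?subr_ge0 ?mulr_ge0 ?(ltW u0) ?(ltW V0) ?(ltW q10) ?(ltW q11) //.
  apply: le_trans Hw _; apply: wsum_le; rewrite ?ler01 ?lexx ?(ltW q10) //.
have [k1 Hk1] := exprn_small q0 q1' (e := 2^-1) ltac:(by rewrite invr_gt0).
have [|k2 Hk2] := @exprn_small R q1 (al / 4 / (MF + 1)) q10 q11.
  by rewrite !divr_gt0 // ltr_wpDl.
have [k0 Hk0] := count_pref_large rec (k1 + k2)%N.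
set k := k0; have cnt := Hk0 k (leqnn _).
set t := count id (pref d k) in cnt.
set h := wsum true u (q * V) (pref d k).
have hlow : ka / (2 * (1 - q)) <= h.
  have /andP[Hw _] := wsum_exp k (ler0n R s) (ltW q0).
  apply: le_trans Hw; rewrite -/ka ler_wpM2l ?(ltW ka0) //.
  have E := wsum1 q (pref d k); rewrite -/t in E.
  have tq : q ^+ t <= 2^-1 by apply/ltW/Hk1/(leq_trans _ cnt)/leq_addr.
  rewrite invfM -ler_pdivlMr ?invr_gt0 ?subr_gt0 // invrK mulrC E; move: tq; lra.
have h1 : 1 <= h.
  apply: le_trans hlow; rewrite ler_pdivlMr ?mulr_gt0 ?subr_gt0 // mul1r.
  apply: (@le_trans _ _ (2 * ep)); first by rewrite ler_pM2l.
  have H3 : 2 * al / ka * ep <= al by rewrite -[leRHS]epD ler_pM2r // /D; move: D1 D2 D3 al0; lra.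
  have {}H3 : 2 * al * ep <= al * ka by rewrite -ler_pdivrMr // mulrAC.
  by rewrite -(ler_pM2l al0); move: H3; lra.
have h0 : 0 < h by exact: lt_le_trans ltr01 h1.
have Lh : L <= h * (al / 4).
  apply: (@le_trans _ _ (ka / (2 * (1 - q)) * (al / 4))); last by rewrite ler_pM2r ?divr_gt0.
  rewrite mulrAC ler_pdivlMr ?mulr_gt0 ?subr_gt0 //.
  apply: (@le_trans _ _ (L * (2 * ep))); first by rewrite ler_wpM2l // ler_pM2l.
  have H2 : 8 * L / ka * ep <= al by rewrite -[leRHS]epD ler_pM2r // /D; move: D1 D2 D3 al0; lra.
  have {}H2 : 8 * L * ep <= al * ka by rewrite -ler_pdivrMr // mulrAC.
  by move: H2; lra.
have mL : m%:R * L * (1 - q) <= al / 4.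
  apply: (@le_trans _ _ (m%:R * L * ep)); first by rewrite ler_wpM2l ?mulr_ge0.
  have H1 : 4 * m%:R * L * ep <= al by rewrite -[leRHS]epD ler_pM2r // /D; move: D1 D2 D3 al0; lra.
  by move: H1; lra.
have Vq0 : 0 <= q * V by rewrite mulr_ge0 ?ltW.
have VqV : q * V <= V by rewrite ler_piMl ?ltW.
have lead : al - al / 4 <= `|pcoef c u (q * V) r|.
  have Hd : `|pcoef c u V r - pcoef c u (q * V) r| <= al / 4.
    apply: le_trans mL; rewrite /pcoef -sumrB.
    apply: le_trans (ler_norm_sum _ _ _) _.
    apply: (@le_trans _ _ (La r * (m%:R * (1 - q)))).
      rewrite /La mulr_suml; apply: ler_sum => p _.
      have -> : (c (p, r))%:~R * (u ^+ p.1 * V ^+ p.2) - (c (p, r))%:~R * (u ^+ p.1 * (q * V) ^+ p.2) =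
        (c (p, r))%:~R * (u ^+ p.1 * V ^+ p.2) * (1 - q ^+ p.2) by rewrite exprMn; ring.
      rewrite normrM normrM (ger0_norm (x := _ * _ ^+ _)) ?mulr_ge0 ?exprn_ge0 ?(ltW u0) ?(ltW V0) //.
      rewrite ler_wpM2l ?mulr_ge0 ?exprn_ge0 ?(ltW u0) ?(ltW V0) //.
      have q_le1 : q ^+ p.2 <= 1 by rewrite exprn_ile1 ?(ltW q0) ?(ltW q1').
      rewrite ger0_norm ?subr_ge0 //.
      have bern j : 1 - q ^+ j <= j%:R * (1 - q).
        elim: j => [|j IH]; first by rewrite expr0 subrr mul0r.
        have qj : q ^+ j <= 1 by rewrite exprn_ile1 ?(ltW q0) ?(ltW q1').
        have : q ^+ j * (1 - q) <= 1 * (1 - q) by rewrite ler_pM2r ?subr_gt0.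
        by rewrite exprSr -natr1; move: IH; lra.
      apply: le_trans (bern p.2) _; rewrite ler_wpM2r ?subr_ge0 ?(ltW q1') //.
      by rewrite ler_nat ltnW.
    rewrite mulrA [La r * _]mulrC ler_wpM2r ?subr_ge0 ?(ltW q1') // ler_wpM2l //.
  by have := ler_distD 0 (pcoef c u V r) (pcoef c u (q * V) r); have := lerB_normD (pcoef c u V r) (- (pcoef c u (q * V) r)); rewrite normrN -/al; move: Hd; lra.
pose rest := \sum_(l < m | l != r) pcoef c u (q * V) l * h ^+ l.
have pE : peval c u (q * V) h = pcoef c u (q * V) r * h ^+ r + rest.
  by rewrite pevalE (bigD1 r).
have Hrest : h * `|rest| <= h ^+ r * L.
  apply: (@le_trans _ _ (h * \sum_(l < m | l != r) `|pcoef c u (q * V) l * h ^+ l|)).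
    by rewrite ler_wpM2l ?(ltW h0) // ler_norm_sum.
  rewrite mulr_sumr /L mulr_sumr.
  apply: (@le_trans _ _ (\sum_(l < m | l != r) h ^+ r * La l)); last first.
    by rewrite [leRHS](bigD1 r) //= lerDr mulr_ge0 ?exprn_ge0 ?(ltW h0).
  apply: ler_sum => l lr; rewrite normrM normrX (gtr0_norm h0) mulrCA -exprS mulrC.
  have [lr'|rl] := ltnP l r; last first.
    have -> : pcoef c u (q * V) l = 0.
      rewrite /pcoef big1 // => p _; have [->|/rmax lr2] := eqVneq (c (p, l)) 0; first by rewrite mul0r.
      by move: lr; rewrite -val_eqE /= eqn_leq lr2 rl.
    by rewrite normr0 mulr0 mulr_ge0 ?exprn_ge0 ?(ltW h0).
  rewrite ler_pM ?exprn_ge0 ?(ltW h0) //; first by rewrite ler_weXn2l.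
  rewrite /pcoef /La; apply: le_trans (ler_norm_sum _ _ _) _; apply: ler_sum => p _.
  rewrite normrM ler_wpM2l // ger0_norm ?mulr_ge0 ?exprn_ge0 ?(ltW u0) //.
  by rewrite ler_wpM2l ?exprn_ge0 ?(ltW u0) // lerXn2r ?nnegrE ?(ltW V0).
have big : al / 2 <= `|peval c u (q * V) h|.
  have hr1 : 1 <= h ^+ r by rewrite exprn_ege1.
  have hr0 : 0 < h ^+ r by rewrite exprn_gt0.
  have H1 : h ^+ r * (al - al / 4) - `|rest| <= `|peval c u (q * V) h|.
    rewrite pE; apply: le_trans (lerB_normD _ _); rewrite lerD2r normrM normrX (gtr0_norm h0) mulrC.
    by rewrite ler_pM2r.
  have H2 : `|rest| <= h ^+ r * (al / 4).
    rewrite -(ler_pM2l h0); apply: le_trans Hrest _.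
    by rewrite [leRHS]mulrCA ler_pM2l.
  have H3 : al / 2 <= h ^+ r * (al / 2) by rewrite ler_peMl // divr_ge0 // ltW.
  by move: H1 H2 H3; lra.
have := small k; rewrite -/h -/t => sm.
have qt : q1 ^+ t <= al / 4 / (MF + 1) by apply/ltW/Hk2/(leq_trans _ cnt)/leq_addl.
have MF1 : 0 < MF + 1 by rewrite ltr_wpDl.
have : q1 ^+ t * MF <= al / 4.
  apply: (@le_trans _ _ (al / 4 / (MF + 1) * (MF + 1))); last by rewrite divfK // gt_eqF.
  by rewrite ler_pM ?exprn_ge0 ?(ltW q10) // lerDl.
by move: sm big; lra.
Qed.

End Transcendence.

(** * Bounded runs: the auxiliary polynomial *)

Lemma peval_diff (S : comNzRingType) m (c : cube m -> int) (u v h h' : S) :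
  peval c u v h' - peval c u v h = \sum_(t : cube m) (c t)%:~R * (u ^+ t.1.1 * v ^+ t.1.2) *
     ((h' - h) * \sum_(i < t.2) h' ^+ (t.2.-1 - i) * h ^+ i).
Proof.
by rewrite /peval -sumrB; apply: eq_bigr => t _; rewrite -subrXX; ring.
Qed.

(** Extending [w] changes its sum by a multiple of [v ^ count id w], so the lower coefficients in
    [v] are final. *)
Lemma bipoly_stable m (c : cube m -> int) w s j : (j < count id w)%N ->
  (bipoly c (w ++ s))`_j = (bipoly c w)`_j.
Proof.
move=> Hj; apply/eqP; rewrite -subr_eq0 -coefB /bipoly peval_diff; apply/eqP.
rewrite coef_sum big1 // => t _; rewrite wsum_cat addrC addKr /monom.
set Y := wsum _ _ _ s; set T := \sum_(_ < _) _.
set U := _%:~R * _; set U' := _ ^+ count negb w.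
have -> : U * (U' * 'X ^+ count id w * Y * T) = U * U' * Y * T * 'X^(count id w) by ring.
by rewrite coefMXn Hj.
Qed.

Lemma pref_extend d k k' : (k <= k')%N -> exists s, pref d k' = pref d k ++ s.
Proof.
move=> /subnKC <-; elim: (k' - k)%N => [|j [s IH]]; first by exists [::]; rewrite addn0 cats0.
rewrite addnS; have -> : pref d (k + j).+1 = pref d (k + j) ++ sig d (k + j) (nseq (~~ d (k + j)%N) false).
  rewrite /pref /= /sub /=; case: (d (k + j)%N) => /=.
    by rewrite [sig d _ [::]]sigE /= cats0.
  by rewrite [LHS]sigE /= cats0.
by rewrite IH -catA; eexists.
Qed.

(** These are [M * M] homogeneous linear conditions on [m * m * m] unknowns, so a nonzero rational
    solution exists. *)
Lemma aux_poly m M w : (M * M < m * m * m)%N ->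
  exists c : cube m -> int, (exists t, c t != 0) /\
    forall i j, (i < M)%N -> (j < M)%N -> (bipoly c w)`_j`_i = 0.
Proof.
move=> HM.
pose mon (t : cube m) : {poly {poly int}} :=
  (('X)%:P ^+ t.1.1 * 'X ^+ t.1.2 * (wsum true ('X)%:P 'X w) ^+ t.2).
have cz (S : nzRingType) (P : {poly S}) (z : int) k : (P *~ z)`_k = P`_k *~ z.
  exact: (raddfMz (coefp k)).
have coefE (c : cube m -> int) j i : (bipoly c w)`_j`_i = \sum_t c t * (mon t)`_j`_i.
  rewrite /bipoly /peval !coef_sum; apply: eq_bigr => t _.
  rewrite -/(mon t) mulrzl.
  by rewrite !cz -mulrzl intz.
pose A : 'M[rat]_(#|{: cube m}|, #|{: 'I_M * 'I_M}|) :=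
  \matrix_(k, l) (let q : 'I_M * 'I_M := enum_val l in (mon (enum_val k))`_q.2`_q.1)%:~R.
have rk : (\rank A < #|{: cube m}|)%N.
  apply: leq_ltn_trans (rank_leq_col _) _.
  by rewrite !card_prod !card_ord.
have kz : nz_row (kermx A) != 0.
  by rewrite nz_row_eq0 -mxrank_eq0 mxrank_ker subn_eq0 -ltnNge.
set r := nz_row (kermx A) in kz.
have rA : r *m A = 0 by apply/sub_kermxP/nz_row_sub.
(* The row is read as a polynomial in order to clear its denominators. *)
have [p [a a0 E]] := rat_poly_scale (rVpoly r).
have a0' : a%:~R != 0 :> rat by rewrite intr_eq0.
have rE k : r 0 k = a%:~R^-1 * (p`_k)%:~R.
  by rewrite -coef_rVpoly_ord E coefZ coef_map.
exists (fun t => p`_(enum_rank t)); split.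
  apply: contrapT => H; move/eqP: kz; apply; apply/rowP => k; rewrite rE mxE.
  have -> : p`_k = 0; last by rewrite mulr0.
  by apply/eqP/negPn/negP => nz; apply: H; exists (enum_val k); rewrite enum_valK.
move=> i j Hi Hj; rewrite coefE; apply/eqP; rewrite -(intr_eq0 rat) rmorph_sum /=.
have := congr1 (fun B : 'rV[rat]_ _ => B 0 (enum_rank (Ordinal Hi, Ordinal Hj))) rA.
rewrite mxE [(0 : 'M__) _ _]mxE => H.
have H' : a%:~R^-1 * \sum_(k : 'I_#|{: cube m}|) (p`_(enum_rank (enum_val k)))%:~R * ((mon (enum_val k))`_j`_i)%:~R = 0 :> rat.
  rewrite -[RHS]H mulr_sumr; apply: eq_bigr => k _.
  by rewrite rE mxE enum_rankK /= enum_valK mulrA.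
move/eqP: H'; rewrite mulf_eq0 invr_eq0 (negbTE a0') /= => /eqP H'; apply/eqP; rewrite -[RHS]H'.
rewrite (reindex_onto (enum_val : 'I_#|{: cube m}| -> cube m) enum_rank) /=; last by move=> t _; rewrite enum_rankK.
by apply: eq_big => k; rewrite ?enum_valK ?eqxx // => _; rewrite rmorphM.
Qed.

Lemma bipoly_eval (R : realType) m (c : cube m -> int) w (u v : R) N :
  let E := bipoly c w in (size E <= N)%N -> (forall j, (size (E`_j)%R <= N)%N) ->
  peval c u v (wsum true u v w) =
    \sum_(p : 'I_N * 'I_N) (E`_p.2`_p.1)%:~R * (u ^+ p.1 * v ^+ p.2).
Proof.
move=> E sE sEj.
transitivity ((map_poly (ieval u) E).[v]).
  rewrite /E /bipoly rmorph_peval rmorph_wsum /= map_polyC map_polyX /=.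
  have -> : ieval u 'X = u by rewrite /ieval map_polyX hornerX.
  rewrite -[RHS]/(horner_eval v _) rmorph_peval rmorph_wsum /=.
  by rewrite /horner_eval hornerC hornerX.
rewrite (@horner_coef_wide _ N); last by apply: leq_trans (size_poly _ _) sE.
under eq_bigr => j _ do rewrite coef_map /= (ievalE _ (sEj j)) mulr_suml.
rewrite exchange_big /= pair_bigA /=; apply: eq_bigr => p _ /=.
by rewrite mulrA.
Qed.

Lemma bipoly_size m (c : cube m -> int) w : let E := bipoly c w in
  exists N, (size E <= N)%N /\ forall j, (size (E`_j)%R <= N)%N.
Proof.
move=> E; exists (size E + \sum_(j < size E) size (E`_j)%R)%N; split=> [|j]; first exact: leq_addr.
have [Hj|Hj] := ltnP j (size E); last by rewrite nth_default // size_poly0.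
by apply: leq_trans (leq_addl _ _); rewrite (bigD1 (Ordinal Hj)) //= leq_addr.
Qed.

Lemma absz_form (A B x y x' y' : nat) :
  absz ((x%:Z - x'%:Z) * A%:Z + (y%:Z - y'%:Z) * B%:Z) =
  absz ((A * x + B * y)%N%:Z - (A * x' + B * y')%N%:Z).
Proof. by congr absz; rewrite !PoszD !PoszM; ring. Qed.

Section Bounded.
Variables (R : realType) (z X C0 : R) (a b : int) (W : nat -> nat -> bool) (d : nat -> bool).
Hypotheses (z0 : 0 < z) (z1 : z < 1) (ab : a < b) (C0_ge0 : 0 <= C0).
Hypothesis alg : algebraicOver (ratr : rat -> R) z.
Hypothesis XE : (b - a)%:~R * z * (1 - z) * X = 1 - (1 + a%:~R) * z.
Hypothesis approxX : forall s, occ (W 0) 0 s -> `|X - wsum true z z s| <= C0 * z ^+ size s.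
Hypothesis dW : directive W d.

Local Notation u n := (lu z d n).
Local Notation v n := (lv z d n).
Local Notation h n := (lh z X d n).
Local Notation C1 := (approx_const z C0).

(** Both [h n] and the finite sum are bounded by [Hb] at every level, so [K] depends on [c] but not
    on [n]. *)
Lemma peval_lipschitz m (c : cube m -> int) : exists2 K : R, 0 <= K & forall n w, occ (W n) 0 w ->
  monom (u n) (v n) w <= u n ->
  `|peval c (u n) (v n) (h n) - peval c (u n) (v n) (wsum true (u n) (v n) w)|
    <= K * (monom (u n) (v n) w / u n).
Proof.
have C10 : 0 <= C1 by exact: approx_const_ge0.
have z1' : 0 < 1 - z by rewrite subr_gt0.
pose Hb := (1 - z)^-1 + C1.
have Hb1 : 1 <= Hb.
  have : 1 <= (1 - z)^-1 by rewrite invf_ge1 // gerBl ltW.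
  by rewrite /Hb; move: C10; lra.
have Hb0 : 0 <= Hb by exact: le_trans ler01 Hb1.
pose T := \sum_(t : cube m) `|(c t)%:~R| * (m%:R * Hb ^+ m) : R.
have T0 : 0 <= T by apply: sumr_ge0 => t _; rewrite !mulr_ge0 ?exprn_ge0.
exists (T * C1); first exact: mulr_ge0.
move=> n w Hw mu; have u0 := lu_gt0 d z0 n; have v0 := lv_gt0 d z0 n.
have u1 : u n <= 1 by apply: le_trans (lu_le d z0 z1 n) (ltW z1).
have vz : v n <= z by exact: lv_le.
have v1 : v n < 1 by exact: le_lt_trans vz z1.
have ap := level_approx z0 z1 approxX dW Hw.
set H := wsum true (u n) (v n) w in ap *; set mo := monom (u n) (v n) w in mu ap *.
have mo0 : 0 <= mo by apply: monom_ge0; exact: ltW.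
have mo1 : mo / u n <= 1 by rewrite ler_pdivrMr // mul1r.
have H0 : 0 <= H by apply: wsum_ge0; exact: ltW.
have Hle : `|H| <= Hb.
  rewrite ger0_norm //; apply: (@le_trans _ _ ((1 - v n)^-1)).
    by apply: wsum_le => //; rewrite ?u1 ?(ltW u0) ?(ltW v0) ?(ltW z0) ?(ltW z1).
  by rewrite /Hb -[leLHS]addr0 lerD // lef_pV2 ?posrE ?subr_gt0 // lerD2l lerN2.
have hle : `|h n| <= Hb.
  have -> : h n = H + (h n - H) by rewrite addrC subrK.
  apply: le_trans (ler_normD _ _) _; rewrite /Hb lerD //.
    rewrite ger0_norm //; apply: (@le_trans _ _ ((1 - v n)^-1)).
      by apply: wsum_le => //; rewrite ?u1 ?(ltW u0) ?(ltW v0) ?(ltW z0) ?(ltW z1).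
    by rewrite lef_pV2 ?posrE ?subr_gt0 // lerD2l lerN2.
  by apply: le_trans ap _; rewrite ler_piMr.
rewrite peval_diff; apply: le_trans (ler_norm_sum _ _ _) _.
apply: (@le_trans _ _ (T * `|h n - H|)); last by rewrite -mulrA ler_wpM2l.
rewrite /T mulr_suml; apply: ler_sum => t _.
rewrite normrM [ `|(c t)%:~R * _| ]normrM -[leRHS]mulrA ler_pM ?mulr_ge0 //.
  rewrite ler_piMr // ger0_norm ?mulr_ge0 ?exprn_ge0 ?(ltW u0) ?(ltW v0) ?(ltW z0) ?(ltW z1) //.
  by apply: mulr_ile1; rewrite ?exprn_ge0 ?exprn_ile1 ?(ltW u0) ?(ltW v0) ?(ltW z0) ?(ltW z1) ?(ltW v1).
rewrite normrM [leRHS]mulrC ler_wpM2l //; apply: le_trans (ler_norm_sum _ _ _) _.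
apply: (@le_trans _ _ (\sum_(i < t.2) Hb ^+ m)).
  apply: ler_sum => i _; rewrite normrM !normrX.
  apply: (@le_trans _ _ (Hb ^+ (t.2.-1 - i) * Hb ^+ i)).
    by rewrite ler_pM ?exprn_ge0 // lerXn2r ?nnegrE.
  rewrite -exprD ler_weXn2l // subnK; first exact: leq_trans (leq_pred _) (ltnW (ltn_ord t.2)).
  by rewrite -ltnS (ltn_predK (ltn_ord i)).
rewrite sumr_const card_ord -[leLHS]mulr_natl ler_wpM2r ?exprn_ge0 // ler_nat; exact: ltnW.
Qed.

Theorem bounded_runs_absurd r : bounded_runs d r -> False.
Proof.
move=> bd.
have [B [B1 key]] := @key_lower_bound R z X a b d z0 z1 ab alg XE.
have B0 : 0 < B by exact: lt_le_trans ltr01 B1.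
have [d' lim] := limit_word d.
have bd' := limit_bounded_runs bd lim.
have rec' c n : exists2 m, (n <= m)%N & d' m = c.
  by have [i _ E] := bd' n c; exists (n + i)%N; rewrite ?leq_addr.
have [th [th0 slope]] := slope_exists R rec'.
have disc := pref_discrepancy rec' th0 slope.
have irr := slope_irrational rec' th0 slope.
pose C2 := (2 ^ r)%N; have C20 : (0 < C2)%N by rewrite expn_gt0.
have ratio l n : (r <= n)%N -> (lsum d n <= C2 * len d l n)%N by exact: len_ratio.
(* With [m = K^2] and [M = K^3 - 1], the gain [z ^ (M l / C2)] beats the loss [B ^ (m l)]. *)
have [|K' HK'] := @exprn_small R z (2^-1 / B) z0 z1; first by rewrite divr_gt0 ?invr_gt0.
have {}HK' : z ^+ K' * B <= 2^-1 by rewrite -ler_pdivlMr // ltW // HK'.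
have [K KE] : exists K, K = (C2 * K'.+1)%N by eexists.
have K0 : (0 < K)%N by rewrite KE muln_gt0 C20.
pose m := (K * K)%N; pose M := (K * K * K - 1)%N.
have m0 : (0 < m)%N by rewrite muln_gt0 K0.
have MM : (M * M < m * m * m)%N.
  have HM : (M < K * K * K)%N by rewrite /M subn1 prednK // !muln_gt0 K0.
  have -> : (m * m * m = K * K * K * (K * K * K))%N by rewrite /m; ring.
  by apply: ltn_mul.
have MC : (C2 * (m * K') <= M)%N.
  have E : (K * K * K = C2 * (m * K') + m * C2)%N by rewrite /m [in X in (_ * X = _)%N]KE; ring.
  by rewrite /M E -addnBA ?leq_addr // muln_gt0 m0.
(* With at least [M] ones in [pref d' k1], the coefficients annihilated by [aux_poly] are stable. *)
have [k1 Hk1] := count_pref_large rec' M.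
have [c [[t1 ct1] Hc]] := aux_poly (pref d' k1) MM.
have [k2 [j0 [i0 [Hj0 nz0]]]] := bipoly_neq0 rec' disc irr ct1.
(* The truncation error is of order [v ^+ count id w / u] and must be smaller than
   [u ^+ i0 * v ^+ j0]. As [v ^+ C2 <= u], one batch of [C2] ones pays for the division by [u],
   [C2 * i0] ones pay for [u ^+ i0], and one more gives a spare factor [v]. *)
have [k3 Hk3] := count_pref_large rec' (C2 + (C2 * i0 + j0).+1).
pose k := (k1 + k2 + k3)%N; pose w := pref d' k.
have tw : (C2 + (C2 * i0 + j0).+1 <= count id w)%N by apply: Hk3; exact: leq_addl.
pose E := bipoly c w.
have E1 i j : (i < M)%N -> (j < M)%N -> E`_j`_i = 0.
  move=> Hi Hj; have [s Es] : exists s, w = pref d' k1 ++ s.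
    by apply: pref_extend; rewrite /k -addnA leq_addr.
  by rewrite /E Es bipoly_stable ?Hc // (leq_trans Hj) // Hk1.
have E2 : E`_j0`_i0 != 0.
  have [s Es] : exists s, w = pref d' k2 ++ s.
    by apply: pref_extend; rewrite /k addnAC leq_addl.
  by rewrite /E Es bipoly_stable.
have [N [sE sEj]] := bipoly_size c w; rewrite -/E in sE sEj.
have Hj0N : (j0 < N)%N.
  apply: leq_trans sE; rewrite ltnNge; apply/negP => H; move: E2.
  by rewrite (nth_default 0 H) coef0 eqxx.
have Hi0N : (i0 < N)%N.
  apply: leq_trans (sEj j0); rewrite ltnNge; apply/negP => H; move: E2.
  by rewrite (nth_default 0 H) eqxx.
pose p1 : 'I_N * 'I_N := (Ordinal Hi0N, Ordinal Hj0N).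
pose ce (p : 'I_N * 'I_N) : int := E`_p.2`_p.1.
pose S : R := \sum_p `|(ce p)%:~R|; have S0 : 0 <= S by exact: sumr_ge0.
pose e : R := 2^-1 / (S + 1).
have S1 : 0 < S + 1 by move: S0; lra.
have e0 : 0 < e by rewrite divr_gt0 ?invr_gt0.
have [re Hre] := exprn_small z0 z1 e0.
pose mn n (p : 'I_N * 'I_N) : R := u n ^+ p.1 * v n ^+ p.2.
have mnE n p : mn n p = z ^+ (len d false n * p.1 + len d true n * p.2).
  by rewrite /mn /lu /lv -!exprM -exprD.
(* The exponents of [z] in two distinct monomials differ by a nontrivial integer form in the two
   lengths, which [form_bound] makes larger than [re] in absolute value. *)
have [n1 Hn1] : exists n1, forall n, (n1 <= n)%N -> forall pp : ('I_N * 'I_N) * ('I_N * 'I_N),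
    pp.1 != pp.2 -> mn n pp.1 <= e * mn n pp.2 \/ mn n pp.2 <= e * mn n pp.1.
  apply: eventually_fin => -[p p'] /=.
  have [<-|ne] := eqVneq p p'; first by exists 0%N.
  have nz : (p.1%:Z - p'.1%:Z != 0) || (p.2%:Z - p'.2%:Z != 0).
    apply: contraNT ne; rewrite negb_or !negbK !subr_eq0 => /andP[/eqP[e1] /eqP[e2]].
    by case: p p' e1 e2 => [? ?] [? ?] /= /val_inj-> /val_inj->.
  have [ka [n2 Hn2]] := form_bound bd nz.
  have [n3 Hn3] := lsum_large d (ka * re).+1.
  exists (n2 + n3)%N => n Hn _.
  have {}Hn2 := Hn2 n (leq_trans (leq_addr _ _) Hn).
  have {}Hn3 := Hn3 n (leq_trans (leq_addl _ _) Hn).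
  have key2 (q q' : 'I_N * 'I_N) : (len d false n * q'.1 + len d true n * q'.2 + re <=
      len d false n * q.1 + len d true n * q.2)%N -> mn n q <= e * mn n q'.
    move=> Hq; rewrite !mnE -(subnKC Hq) -addnA [(re + _)%N]addnC.
    set x1 := (_ * _ + _)%N; set x2 := (_ - _)%N.
    rewrite addnA addnC exprD ler_pM ?exprn_ge0 ?(ltW z0) //.
      exact/ltW/Hre.
    by rewrite ler_wiXn2l ?(ltW z0) ?(ltW z1) // leq_addr.
  have := leq_trans Hn3 Hn2; rewrite ltnNge leq_mul2l negb_or -ltnNge => /andP[_ Hre'].
  have {key2} := (key2 p p', key2 p' p); move: Hre'; rewrite absz_form.
  move: (len d false n * p.1 + len d true n * p.2)%N => x1.
  move: (len d false n * p'.1 + len d true n * p'.2)%N => x2 Hre' [key2 key2'].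
  have [le|lt] := leqP x2 x1.
    by left; apply: key2; move: Hre' le; clear; lia.
  by right; apply: key2'; move: Hre' lt; clear; lia.
have [Kl Kl0 Hlip] := peval_lipschitz c.
have [rk Hrk] := @exprn_small R z ((4 * (Kl + 1))^-1) z0 z1
  ltac:(by rewrite invr_gt0 mulr_gt0 // (le_lt_trans Kl0) // ltrDl).
have [A [A0 keyA]] := key m c m0.
have h2 : (2^-1 : R) < 1 by rewrite invf_lt1 // ltr1n.
have [rl Hrl] := @exprn_small R (2^-1) (((S + 1) * A)^-1) ltac:(by rewrite invr_gt0) h2
   ltac:(by rewrite invr_gt0 mulr_gt0).
have [n4 Hn4] := lsum_large d (rl + C2 * rk)%N.
(* At this level [d] coincides with [d'] on [k] letters, so that [W n] begins with [w]. *)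
have [n Hn match_d] := lim k (r + n1 + n4)%N.
have rn : (r <= n)%N by apply: leq_trans Hn; rewrite -addnA leq_addr.
have {}Hn1 := Hn1 n (leq_trans (leq_trans (leq_addl r n1) (leq_addr n4 _)) Hn).
have {}Hn4 := Hn4 n (leq_trans (leq_addl _ _) Hn).
have wE : w = pref (fun i => d (n + i)%N) k by apply: eq_sig => i Hi; rewrite match_d.
have occw : occ (W n) 0 w by rewrite wE; exact: directive_pref.
have u0 := lu_gt0 d z0 n; have v0 := lv_gt0 d z0 n.
set lA := len d false n; set lB := len d true n; set l := lsum d n.
have lE : l = (lA + lB)%N by [].
have rA : (l <= C2 * lA)%N by exact: ratio.
have rB : (l <= C2 * lB)%N by exact: ratio.
have v1 : v n < 1 by apply: le_lt_trans (lv_le d z0 z1 n) z1.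
have u1 : u n < 1 by apply: le_lt_trans (lu_le d z0 z1 n) z1.
have vu : v n ^+ C2 <= u n.
  by rewrite /lv /lu -exprM ler_wiXn2l ?(ltW z0) ?(ltW z1) // mulnC; apply: leq_trans rB; rewrite lE leq_addr.
have [|||||p0 [cp0 pmax plow]] := @dominant R _ ce (mn n) e p1.
- by move=> p; rewrite mnE exprn_gt0.
- exact: E2.
- exact: ltW.
- rewrite -/S /e mulrAC ler_pdivrMr // ler_wpM2l ?invr_ge0 //; move: S0; lra.
- by move=> i j ij _ _; exact: (Hn1 (i, j)).
have EE : peval c (u n) (v n) (wsum true (u n) (v n) w) = \sum_p (ce p)%:~R * mn n p.
  exact: bipoly_eval.
set P := peval c (u n) (v n) (h n).
set Pw := \sum_p (ce p)%:~R * mn n p in plow EE.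
have mp0 : 0 < mn n p0 by rewrite mnE exprn_gt0.
have p1low : v n ^+ (C2 * i0 + j0) <= mn n p0.
  apply: le_trans (pmax p1 E2); rewrite /mn /= exprD exprM ler_wpM2r ?exprn_ge0 ?(ltW v0) ?(ltW z0) ?(ltW z1) //.
  by rewrite lerXn2r ?nnegrE ?exprn_ge0 ?(ltW v0) ?(ltW z0) ?(ltW z1) ?(ltW u0) ?(ltW z0) ?(ltW z1).
have mow : monom (u n) (v n) w <= v n ^+ (C2 * i0 + j0).+1 * u n.
  apply: (@le_trans _ _ (v n ^+ count id w)).
    by rewrite /monom ler_piMl ?exprn_ge0 ?(ltW v0) ?(ltW z0) ?(ltW z1) // exprn_ile1 ?(ltW u0) ?(ltW z0) ?(ltW z1) ?(ltW u1).
  apply: (@le_trans _ _ (v n ^+ ((C2 * i0 + j0).+1 + C2))).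
    by rewrite ler_wiXn2l ?(ltW v0) ?(ltW z0) ?(ltW z1) ?(ltW v1) // addnC.
  by rewrite exprD ler_wpM2l ?exprn_ge0 ?(ltW v0) ?(ltW z0) ?(ltW z1).
have mow1 : monom (u n) (v n) w <= u n.
  apply: le_trans mow _; rewrite ler_piMl ?(ltW u0) ?(ltW z0) ?(ltW z1) // exprn_ile1 ?(ltW v0) ?(ltW z0) ?(ltW z1) ?(ltW v1) //.
have vrk : v n <= (4 * (Kl + 1))^-1.
  apply/ltW/Hrk; have : (C2 * rk <= C2 * lB)%N by apply: leq_trans rB; apply: leq_trans Hn4; exact: leq_addl.
  by rewrite leq_pmul2l.
have Kl1 : 0 < Kl + 1 by move: Kl0; lra.
have diff : `|P - Pw| <= mn n p0 / 4.
  rewrite -EE; apply: le_trans (Hlip n w occw mow1) _.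
  apply: (@le_trans _ _ ((Kl + 1) * (v n * mn n p0))).
    rewrite ler_pM ?divr_ge0 ?monom_ge0 ?(ltW u0) ?(ltW v0) ?(ltW z0) ?(ltW z1) ?lerDl //.
    rewrite ler_pdivrMr //; apply: le_trans mow _; rewrite ler_pM2r // exprS ler_pM2l //.
  rewrite mulrA [leRHS]mulrC ler_pM2r // mulrC -ler_pdivlMr //.
  by rewrite -invfM mulrC [(_ + _) * _]mulrC.
have Pge : mn n p0 / 4 <= `|P|.
  have := ler_distD 0 P Pw; have : `|Pw| - `|P - Pw| <= `|P|.
    have := ler_normD P (Pw - P); rewrite addrC subrK distrC; lra.
  by move: plow diff; lra.
have P0 : P != 0 by rewrite -normr_gt0; apply: lt_le_trans Pge; rewrite divr_gt0.
have Ple : `|P| <= (S + 1) * mn n p0.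
  have : `|P| <= `|Pw| + `|P - Pw|.
    by have := ler_normD Pw (P - Pw); rewrite addrC subrK addrC.
  have : `|Pw| <= S * mn n p0.
    rewrite /Pw /S mulr_suml; apply: le_trans (ler_norm_sum _ _ _) _; apply: ler_sum => p _.
    rewrite normrM (gtr0_norm (x := mn n p)); last by rewrite mnE exprn_gt0.
    have [->|cp] := eqVneq (ce p) 0; first by rewrite normr0 !mul0r.
    by rewrite ler_wpM2l // pmax.
  by move: diff mp0; lra.
(* The coefficients with both exponents below [M] vanish, so the dominant monomial has an exponent
   at least [M], and each length is at least [l / C2]. *)
have mle : mn n p0 <= z ^+ (K' * (m * l)).
  have big : (M <= p0.1)%N || (M <= p0.2)%N.
    rewrite leqNgt (leqNgt M); apply/negPn/negP => /norP[]; rewrite !negbK => H1 H2.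
    by move: cp0; rewrite /ce E1 // eqxx.
  rewrite mnE ler_wiXn2l ?(ltW z0) ?(ltW z1) //.
  have arrn (x1 : nat) : (x1 * (C2 * (m * K')) = K' * m * (C2 * x1))%N by ring.
  have HA : (K' * (m * l) <= lA * M)%N.
    by apply: leq_trans (leq_mul (leqnn lA) MC); rewrite arrn mulnA leq_mul2l rA orbT.
  have HB : (K' * (m * l) <= lB * M)%N.
    by apply: leq_trans (leq_mul (leqnn lB) MC); rewrite arrn mulnA leq_mul2l rB orbT.
  case/orP: big => H.
    by apply: leq_trans (leq_addr _ _); apply: leq_trans HA _; rewrite leq_mul2l H orbT.
  by apply: leq_trans (leq_addl _ _); apply: leq_trans HB _; rewrite leq_mul2l H orbT.
have := keyA n P0; apply/negP; rewrite -ltNge -/l.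
apply: (@le_lt_trans _ _ ((S + 1) * z ^+ (K' * (m * l)) * A * B ^+ (m * l))).
  rewrite ler_pM2r ?exprn_gt0 // ler_pM2r //; apply: le_trans Ple _.
  by rewrite ler_pM2l.
have -> : (S + 1) * z ^+ (K' * (m * l)) * A * B ^+ (m * l) =
    (S + 1) * A * (z ^+ K' * B) ^+ (m * l) by rewrite exprM exprMn; ring.
rewrite -ltr_pdivlMl ?mulr_gt0 // mulr1.
have q0 : 0 <= z ^+ K' * B by rewrite mulr_ge0 ?exprn_ge0 ?ltW.
apply: (@le_lt_trans _ _ (2^-1 ^+ (m * l))); first by rewrite lerXn2r ?nnegrE ?invr_ge0.
apply: Hrl; apply: leq_trans (leq_addr (C2 * rk) _) _; apply: leq_trans Hn4 _.
by rewrite leq_pmull.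
Qed.

End Bounded.

(** * Application to the expansion of 1 *)

Lemma wsum_occ (S : comNzRingType) (z : S) (x : nat -> bool) i s : occ x i s ->
  wsum true z z s = \sum_(j < size s) (x (i + j)%N)%:R * z ^+ j.
Proof.
elim: s i => [|l s IH] i /=; first by rewrite big_ord0.
case/andP => /eqP xi /IH->; rewrite big_ord_recl addn0 mulr1 xi if_same mulr_sumr.
congr (_ + _); first by case: l {xi}.
by apply: eq_bigr => j _; rewrite /= /bump /= add1n addSnnS exprS; ring.
Qed.

Theorem theorem11 (R : realType) (beta : R) (a b : int)
    (beta_gt1 : 1 < beta)
    (a_ge0 : 0 <= a) (a_lt_b : a < b) (b_floor : b = Num.floor beta)
    (sturmian_d : sturmian_over a b (beta_expansion1 beta)) :
  transcendental beta.
Proof.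
move=> alg.
have beta0 : 0 < beta by exact: lt_trans beta_gt1.
set z := beta^-1.
have z0 : 0 < z by rewrite invr_gt0.
have z1 : z < 1 by rewrite invf_lt1.
have algz : algebraicOver (ratr : rat -> R) z by exact: (algebraic_inv alg).
have ba0 : 0 < (b - a)%:~R :> R by rewrite ltr0z subr_gt0.
pose D : R := (b - a)%:~R * z * (1 - z).
have D0 : 0 < D by rewrite !mulr_gt0 // subr_gt0.
pose X := (1 - (1 + a%:~R) * z) / D.
have XE : (b - a)%:~R * z * (1 - z) * X = 1 - (1 + a%:~R) * z.
  by rewrite -/D /X mulrC divfK // gt_eqF.
have a0 : 0 <= a%:~R :> R by rewrite ler0z.
pose C0 := (1 + a%:~R) / D.
have C0_ge0 : 0 <= C0 by rewrite divr_ge0 ?(ltW D0) // addr_ge0.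
have [W [d [dW W0]]] := good_directive (eps_good beta_gt1 a_ge0 a_lt_b sturmian_d).
have approxX s : occ (W 0) 0 s -> `|X - wsum true z z s| <= C0 * z ^+ size s.
  rewrite W0 => /(wsum_occ z) ->; set T := \sum_(_ < _) _.
  have E := eps_sum beta_gt1 sturmian_d (size s).
  set t := iter _ _ _ in E.
  have t01 : 0 <= t <= 1 by exact: orbit_itv.
  have -> : X - T = z ^+ size s * ((1 - z) * t - a%:~R * z) / D.
    apply: (mulfI (lt0r_neq0 D0)); rewrite mulrBr {1}/X.
    rewrite [D * (_ / D)]mulrC divfK ?gt_eqF // [in RHS]mulrC divfK ?gt_eqF //.
    have -> : D * T = 1 - (1 + a%:~R) * z - z ^+ size s * ((1 - z) * t - a%:~R * z) := E.
    by ring.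
  rewrite normrM normrM normfV (gtr0_norm D0) normrX (gtr0_norm z0) /C0.
  rewrite -mulrA mulrC ler_wpM2r ?exprn_ge0 ?(ltW z0) // ler_wpM2r ?invr_ge0 ?(ltW D0) //.
  apply: le_trans (ler_normB _ _) _; case/andP: t01 => t0 t1.
  rewrite !normrM (ger0_norm t0) (ger0_norm a0) (gtr0_norm z0) gtr0_norm ?subr_gt0 //.
  apply: lerD; last by rewrite ler_piMr // ltW.
  by apply: mulr_ile1; rewrite // ?subr_ge0 ?(ltW z1) // gerBl ltW.
have [|] := pselect (forall r, exists n c, forall i, (i < r)%N -> d (n + i)%N = c).
  exact: (unbounded_runs z0 z1 a_lt_b C0_ge0 algz XE approxX dW).
move=> /existsNP[r Hr].
apply: (@bounded_runs_absurd R z X C0 a b W d z0 z1 a_lt_b C0_ge0 algz XE approxX dW r) => n c.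
apply: contrapT => H; apply: Hr; exists n, (~~ c) => i Hi.
apply: contrapT => Hc; apply: H; exists i => //.
by move: Hc; case: (d _); case: (c).
Qed.
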